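(* Let $p\in(0,1)$. The family $\gamma'_p=(\gamma'_{p,\Lambda})_{\Lambda\Subset\mathbb{Z}}$ of kernels defined, for every finite $\Lambda\subset\mathbb{Z}$ and every $\omega'\in\Omega'$, by $$\gamma'_{p,\Lambda}(\omega'_\Lambda\mid\omega'_{\Lambda^c})=\frac{1}{Z_\Lambda(\omega'_{\Lambda^c})}\,p^{|\Theta\cap\bar\Lambda|}(1-p)^{|\partial_+\Theta\cap\bar\Lambda|}\prod_{U\in\mathscr U_\Lambda(\omega')}Z(U),$$ where $\Theta=\Theta(\omega')$, and $Z_\Lambda(\omega'_{\Lambda^c})$ is the normalizing constant making $\gamma'_{p,\Lambda}(\cdot\mid\omega'_{\Lambda^c})$ a probability distribution on $\{\xi_\Lambda\in\{0,1\}^\Lambda:\ \xi_\Lambda\omega'_{\Lambda^c}\in\Omega'\}$, is a specification on $(\Omega',\mathscr F')$, and the TBF $\mu'_p$ is a Gibbs measure for it, i.e. $\mu'_p\in\mathscr G(\gamma'_p)$.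
   Context: Fix $p\in(0,1)$. Let $\Omega=\{0,1\}^{\mathbb{Z}}$ with product $\sigma$-algebra $\mathscr F$, and $\mu_p=\mathrm{Ber}(p)^{\otimes\mathbb{Z}}$ (each site is occupied, i.e. has value $1$, independently with probability $p$). Define $T:\Omega\to\Omega$ by $(T\omega)_i=\omega_i\big(1-(1-\omega_{i-1})(1-\omega_{i+1})\big)$ (removal of isolated occupied sites). Let $\Omega'=T(\Omega)$ (the configurations in which every occupied site has an occupied neighbour), $\mathscr F'=\mathscr F\cap\Omega'$ the trace $\sigma$-algebra, $\mathscr F'_\Delta$ the trace of the $\sigma$-algebra generated by the spins in $\Delta$, and the thinned Bernoulli field (TBF) $\mu'_p=\mu_p\circ T^{-1}$ on $(\Omega',\mathscr F')$. For $\omega\in\Omega$ and $\Delta\subset\mathbb{Z}$, $\omega_\Delta$ is the restriction to $\Delta$ and $\xi_\Lambda\eta_{\Lambda^c}$ denotes concatenation. Transfer matrix: $Q$ is the $2\times2$ matrix indexed by $\{0,1\}$ with $Q(0,0)=1-p$, $Q(0,1)=Q(1,0)=\sqrt{p(1-p)}$, $Q(1,1)=0$; its eigenvalues are $\lambda_{PF}=\tfrac12\big(1-p+\sqrt{(1-p)(3p+1)}\big)\in(0,1)$ and $\lambda_r=\tfrac12\big(1-p-\sqrt{(1-p)(3p+1)}\big)\in(-\tfrac13,0)$; $Q^m(x,y)$ denotes entries of the $m$-th matrix power. Geometry: for $A\subset\mathbb{Z}$, $\partial_+A=\{j\notin A: |j-i|=1\text{ for some }i\in A\}$ and $\bar A=A\cup\partial_+A$.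 For $\omega'\in\Omega'$ let $\Theta(\omega')=\{x:\omega'_x=1\}$, the fixed area $\bar\Theta=\Theta\cup\partial_+\Theta$, and $\mathscr U(\omega')$ the set of connected components (maximal integer intervals, possibly infinite) of $\mathbb{Z}\setminus\bar\Theta$. For finite $\Lambda$, $\mathscr U_\Lambda(\omega')=\{U\in\mathscr U(\omega'):\mathrm{dist}(\bar\Lambda,U)\le1\}$, $V_-=[\min\bar\Lambda,+\infty)$, $V_+=(-\infty,\max\bar\Lambda]$. For $U\in\mathscr U_\Lambda(\omega')$ set $Z(U)=(1-p)^{-1}Q^{|U|+1}(0,0)$ if $U$ is finite; $Z(U)=(1-p)^{-1}\lambda_{PF}^{|U\cap V_-|}$ if $U$ is infinite with $\sup U<\infty$; $Z(U)=(1-p)^{-1}\lambda_{PF}^{|U\cap V_+|}$ if $U$ is infinite with $\inf U>-\infty$; and $Z(U)=(1-p)^{-1}D\,\lambda_{PF}^{|V_-\cap V_+|}$ if $U=\mathbb{Z}$, where $D=(1-p)(\lambda_{PF}+2p)/\lambda_{PF}^3$. A specification on $(\Omega',\mathscr F')$ is a family of probability kernels $\gamma_\Lambda$, $\Lambda\Subset\mathbb{Z}$, from $(\Omega',\mathscr F'_{\Lambda^c})$ to $(\Omega',\mathscr F')$, which are proper ($\gamma_\Lambda(B\mid\omega)=\mathbb 1_B(\omega)$ for $B\in\mathscr F'_{\Lambda^c}$) and consistent ($\gamma_\Delta\gamma_\Lambda=\gamma_\Delta$ for $\Lambda\subset\Delta\Subset\mathbb{Z}$). A probability measure $\mu$ is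 a Gibbs measure for $\gamma$ ($\mu\in\mathscr G(\gamma)$) if $\mu(B\mid\mathscr F'_{\Lambda^c})=\gamma_\Lambda(B\mid\cdot)$ $\mu$-a.s. for all $\Lambda\Subset\mathbb{Z}$ and $B\in\mathscr F'$. *)

(* Defs.v *)
From HB Require Import structures.
From mathcomp Require Import all_boot all_order all_algebra.
From mathcomp Require Import finmap.
From mathcomp Require Import all_classical all_reals all_analysis.
Set Implicit Arguments. Unset Strict Implicit. Unset Printing Implicit Defensive.
Import Order.TTheory GRing.Theory Num.Theory numFieldNormedType.Exports.
Local Open Scope classical_set_scope.
Local Open Scope ring_scope.

(** Omega = {0,1}^Z ; true = occupied *)
Definition config : Type := int -> bool.

Definition cyl (D : set int) : set (set config) :=
  [set A | exists i, D i /\ exists b : bool, A = [set w : config | w i = b]].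

Definition OmegaM := g_sigma_algebraType (cyl setT).

Definition Tmap (w : config) : config :=
  fun i => w i && (w (i - 1) || w (i + 1)).

Definition Omega' : set config := range Tmap.

Definition trace (S : set (set config)) : set (set config) :=
  [set B | exists A, S A /\ B = Omega' `&` A].

Definition F' : set (set config) := trace <<s cyl setT >>.
Definition F'_ (D : set int) : set (set config) := trace <<s cyl D >>.

Definition Lc (L : {fset int}) : set int := [set x | x \notin L].

Definition glue (L : {fset int}) (xi : {ffun L -> bool}) (w : config) : config :=
  fun i => if insub i is Some j then xi j else w i.

(** closure A-bar = A u d_+A of a finite set given as a sequence *)
Definition barS (s : seq int) : seq int :=
  undup (flatten [seq [:: x - 1; x; x + 1] | x <- s]).

Definition minb (L : {fset int}) : int :=
  \big[Order.min/head 0 (barS L)]_(x <- barS L) x.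
Definition maxb (L : {fset int}) : int :=
  \big[Order.max/head 0 (barS L)]_(x <- barS L) x.

Definition cnt (a b : int) : nat := if a <= b then absz (b - a + 1) else 0%N.

(** x lies in Z \ Theta-bar *)
Definition free (w : config) (x : int) : bool :=
  ~~ w (x - 1) && ~~ w x && ~~ w (x + 1).

(** endpoints of the connected component of Z \ Theta-bar containing x
    (None = infinite in that direction) *)
Definition lend (w : config) (x : int) : option int :=
  match pselect (exists n : nat, ~~ free w (x - n%:Z)) with
  | left h => Some (x - (@ex_minn (fun n : nat => ~~ free w (x - n%:Z)) h)%:Z + 1)
  | right _ => None
  end.
Definition rend (w : config) (x : int) : option int :=
  match pselect (exists n : nat, ~~ free w (x + n%:Z)) with
  | left h => Some (x + (@ex_minn (fun n : nat => ~~ free w (x + n%:Z)) h)%:Z - 1)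
  | right _ => None
  end.
Definition comp (w : config) (x : int) : option int * option int :=
  (lend w x, rend w x).

(** U_Lambda(w): the components U with dist(Lambda-bar, U) <= 1, i.e. those
    containing a free site of (Lambda-bar)-bar, each listed once *)
Definition comps (w : config) (L : {fset int}) : seq (option int * option int) :=
  undup [seq comp w x | x <- barS (barS L) & free w x].

Section Weights.
Variables (R : realType) (p : R).

Definition Qm : 'M[R]_2 :=
  \matrix_(i, j) (if ((i : nat) == 0%N) && ((j : nat) == 0%N) then 1 - p
                  else if ((i : nat) == 1%N) && ((j : nat) == 1%N) then 0
                  else Num.sqrt (p * (1 - p))).

Definition lamPF : R := (1 - p + Num.sqrt ((1 - p) * (3 * p + 1))) / 2.

Definition Dc : R := (1 - p) * (lamPF + 2 * p) / lamPF ^+ 3.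

Definition ZU (L : {fset int}) (c : option int * option int) : R :=
  match c with
  | (Some a, Some b) => (1 - p)^-1 * (Qm ^+ absz (b - a + 2)) 0 0
  | (None, Some b) => (1 - p)^-1 * lamPF ^+ cnt (minb L) b
  | (Some a, None) => (1 - p)^-1 * lamPF ^+ cnt a (maxb L)
  | (None, None) => (1 - p)^-1 * Dc * lamPF ^+ cnt (minb L) (maxb L)
  end.

Definition weight (L : {fset int}) (w : config) : R :=
  p ^+ count (fun x => w x) (barS L)
  * (1 - p) ^+ count (fun x => ~~ w x && (w (x - 1) || w (x + 1))) (barS L)
  * \prod_(c <- comps w L) ZU L c.

Definition ZL (L : {fset int}) (w : config) : R :=
  \sum_(xi : {ffun L -> bool} | `[< Omega' (glue xi w) >]) weight L (glue xi w).

Definition gammaP (L : {fset int}) (w : config) (B : set config) : R :=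
  (\sum_(xi : {ffun L -> bool} | `[< Omega' (glue xi w) >] && `[< B (glue xi w) >])
      weight L (glue xi w)) / ZL L w.

End Weights.

Section Spec.
Variable R : realType.

Definition prob_on_trace (m : set config -> R) : Prop :=
  [/\ forall B, F' B -> 0 <= m B,
      m Omega' = 1 &
      forall Bn : nat -> set config, (forall n, F' (Bn n)) -> trivIset setT Bn ->
        (fun N : nat => \sum_(n < N) m (Bn n)) @ \oo --> m (\bigcup_n Bn n)].

Definition trace_measurable (S : set (set config)) (f : config -> R) : Prop :=
  forall Y : set R, measurable Y -> trace S (Omega' `&` f @^-1` Y).

Definition is_specification (K : {fset int} -> config -> set config -> R) : Prop :=
  [/\
      (forall L w, Omega' w -> prob_on_trace (K L w)),
      (forall L B, F' B -> trace_measurable <<s cyl (Lc L) >> (fun w => K L w B)),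
      (forall L B, F'_ (Lc L) B -> forall w, Omega' w -> K L w B = \1_B w) &
      (forall (L D : {fset int}), (L `<=` D)%fset -> forall w, Omega' w ->
         forall B, F' B ->
         (\int[fun A : set OmegaM => (K D w (Omega' `&` A))%:E]_(v in Omega')
             (K L v B)%:E)%E = (K D w B)%:E)].

(** m in G(K): for every finite Lambda and B in F', K_Lambda(B|.) is a version
    of the conditional probability m(B | F'_{Lambda^c}) *)
Definition is_gibbs (K : {fset int} -> config -> set config -> R)
    (m : set OmegaM -> \bar R) : Prop :=
  forall (L : {fset int}) (B A : set config), F' B -> F'_ (Lc L) A ->
    m (A `&` B) = (\int[m]_(x in A) (K L x B)%:E)%E.

Definition is_bernoulli_product (p : R) (mu : probability OmegaM R) : Prop :=
  forall (L : {fset int}) (eta : config),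
    mu [set w : OmegaM | forall i, i \in L -> w i = eta i]
    = (\prod_(i <- L) (if eta i then p else 1 - p))%:E.

Definition TBF (mu : probability OmegaM R) : set OmegaM -> \bar R :=
  fun A => mu (Tmap @^-1` A).

End Spec.

(* Main.v *)
Require Import Defs.
From HB Require Import structures.
From mathcomp Require Import all_boot all_order all_algebra.
From mathcomp Require Import finmap.
From mathcomp Require Import all_classical all_reals all_analysis.
From mathcomp Require Import measurable_realfun zify ring lra.
Import Defs.
Import Order.TTheory GRing.Theory Num.Theory numFieldNormedType.Exports.
Set Implicit Arguments. Unset Strict Implicit. Unset Printing Implicit Defensive.
Local Open Scope classical_set_scope.
Local Open Scope ring_scope.

(** The quotient [weight D w / weight L w] of the weights of two volumes
    [L `<=` D] only depends on the spins outside [L]: components far from [L]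
    are untouched by the spins in [L], and each infinite component touching [L]
    contributes a power of [lamPF] fixed by the two volumes.  Consistency of
    the kernels follows by exchanging the two layers of resampled spins.

    Under the Bernoulli measure, occupied pairs occur almost surely on both
    sides of [L], so the infinite components play no role for the Gibbs
    property.  Two occupied pairs enclosing [L] decouple the inside of the
    window from the outside, and the probability that the thinned configuration
    takes prescribed values inside is computed site by site with the transfer
    matrix: it is exactly the weight of the window.  The conditional
    probabilities inside [L] are then given by quotients of window weights,
    hence by quotients of weights of [L]. *)

(** * Components of the free region and weights *)

(** The factor of a finite component is a partition function. [Qm] gives a bond the square roots of
    the weights of its two ends and forbids two occupied ends, so [(Qm p ^+ n.+1) 0 0] is [1 - p]
    times the total weight of the fillings of [n] sites between two vacant ones without adjacent
    occupied sites: the fillings that thinning erases. Windows end in occupied pairs rather than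
    single sites because a pair survives thinning whatever lies outside, so the values of the
    thinned configuration in the window depend on the spins in the window alone. Where such pairs
    occur is random. Conditioning events are therefore cut along a countable family of cylinders,
    each prescribing the thinned spins of one window off [L]; on each piece the conditional law is
    elementary, and no limit of growing volumes is taken. *)

Lemma mem_barS (s : seq int) x :
  (x \in barS s) = [|| x - 1 \in s, x \in s | x + 1 \in s].
Proof.
rewrite /barS mem_undup; apply/flattenP/idP => [[t /mapP[y ys ->]]|].
  rewrite !inE => /or3P[] /eqP ->; rewrite ?subrK ?addrK ys ?orbT //.
case/or3P => xs.
- exists [:: x - 1 - 1; x - 1; x - 1 + 1]; first by apply/mapP; exists (x - 1).
  by rewrite !inE subrK eqxx !orbT.
- by exists [:: x - 1; x; x + 1]; [apply/mapP; exists x|rewrite !inE eqxx orbT].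
- exists [:: x + 1 - 1; x + 1; x + 1 + 1]; first by apply/mapP; exists (x + 1).
  by rewrite !inE addrK eqxx.
Qed.

(** A configuration without isolated occupied sites is fixed by [Tmap], hence is its own
    preimage. *)
Lemma Omega'P (w : config) :
  Omega' w <-> forall x, w x -> w (x - 1) || w (x + 1).
Proof.
split=> [[v _ <-] x|wP]; last first.
  exists w => //; apply/funext => x; rewrite /Tmap.
  by case: (w x) (wP x) => //= ->.
rewrite /Tmap => /andP[vx /orP[|] v1]; rewrite v1 ?subrK ?addrK vx ?orbT //.
Qed.

Definition inc (c : option int * option int) (y : int) : bool :=
  (if c.1 is Some a then a <= y else true) &&
  (if c.2 is Some b then y <= b else true).

(** Maximality is tested at the endpoints, with no base point, unlike [comp]. An empty interval can
    also qualify, which is why later statements ask for a point [x] with [inc c x]. *)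
Definition is_comp (w : config) (c : option int * option int) : Prop :=
  [/\ forall y, inc c y -> free w y,
      forall a, c.1 = Some a -> ~~ free w (a - 1) &
      forall b, c.2 = Some b -> ~~ free w (b + 1)].

Lemma lend_spec (w : config) x : free w x ->
  match lend w x with
  | Some a => [/\ a <= x, ~~ free w (a - 1) & forall y, a <= y <= x -> free w y]
  | None => forall y, y <= x -> free w y
  end.
Proof.
move=> fx; rewrite /lend; case: pselect => [h|h]; last first.
  move=> y yx; apply/negPn/negP => nf; apply: h; exists `|x - y|%N.
  by have -> : x - `|x - y|%N%:Z = y by lia.
case: ex_minnP => n nf nmin.
have n0 : (0 < n)%N by case: n nf {nmin} => // /negP[]; rewrite subr0.
split; first by lia.
- by have -> : x - n%:Z + 1 - 1 = x - n%:Z by lia.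
- move=> y yx; apply/negPn/negP => nfy.
  have /nmin : ~~ free w (x - `|x - y|%N%:Z).
    by have -> : x - `|x - y|%N%:Z = y by lia.
  lia.
Qed.

Lemma rend_spec (w : config) x : free w x ->
  match rend w x with
  | Some b => [/\ x <= b, ~~ free w (b + 1) & forall y, x <= y <= b -> free w y]
  | None => forall y, x <= y -> free w y
  end.
Proof.
move=> fx; rewrite /rend; case: pselect => [h|h]; last first.
  move=> y yx; apply/negPn/negP => nf; apply: h; exists `|y - x|%N.
  by have -> : x + `|y - x|%N%:Z = y by lia.
case: ex_minnP => n nf nmin.
have n0 : (0 < n)%N by case: n nf {nmin} => // /negP[]; rewrite addr0.
split; first by lia.
- by have -> : x + n%:Z - 1 + 1 = x + n%:Z by lia.
- move=> y yx; apply/negPn/negP => nfy.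
  have /nmin : ~~ free w (x + `|y - x|%N%:Z).
    by have -> : x + `|y - x|%N%:Z = y by lia.
  lia.
Qed.

Lemma comp_spec (w : config) x : free w x ->
  is_comp w (comp w x) /\ inc (comp w x) x.
Proof.
move=> fx; have := lend_spec fx; have := rend_spec fx.
rewrite /comp /is_comp /inc /=.
case: (rend w x) => [b|] rP; case: (lend w x) => [a|] lP; split; try split.
all: try by case: rP => *; case: lP => *; lia.
all: try by [].
all: try by move=> ? [<-]; case: rP.
all: try by move=> ? [<-]; case: lP.
- move=> y; case: rP => _ _ rP; case: lP => _ _ lP /andP[ay yb].
  by have [yx|xy] := lerP y x; [apply: lP; lia|apply: rP; lia].
- move=> y; case: rP => _ _ rP yb.
  by have [yx|xy] := lerP y x; [apply: lP; lia|apply: rP; lia].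
- by case: rP.
- move=> y; case: lP => _ _ lP; rewrite andbT => ay.
  by have [yx|xy] := lerP y x; [apply: lP; lia|apply: rP; lia].
- by case: lP => ->.
- by move=> y _; have [yx|xy] := lerP y x; [apply: lP; lia|apply: rP; lia].
Qed.

Lemma is_comp_inj (w : config) c c' x :
  is_comp w c -> is_comp w c' -> inc c x -> inc c' x -> c = c'.
Proof.
case: c c' => [l r] [l' r'] [/= f1 l1 r1] [/= f2 l2 r2].
rewrite /inc /= in f1 f2 * => /andP[lx xr] /andP[lx' xr'].
congr pair.
- case: l f1 l1 lx => [a|] f1 l1 lx; case: l' f2 l2 lx' => [a'|] f2 l2 lx' //.
  + congr Some; apply/eqP; case: (ltgtP a a') => // h.
    * case/negP: (l2 _ erefl); apply: f1; move: xr; case: (r) => [b|]; lia.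
    * case/negP: (l1 _ erefl); apply: f2; move: xr'; case: (r') => [b|]; lia.
  + by case/negP: (l1 _ erefl); apply: f2; move: xr'; case: (r') => [b|]; lia.
  + by case/negP: (l2 _ erefl); apply: f1; move: xr; case: (r) => [b|]; lia.
- case: r f1 r1 xr => [a|] f1 r1 xr; case: r' f2 r2 xr' => [a'|] f2 r2 xr' //.
  + congr Some; apply/eqP; case: (ltgtP a a') => // h.
    * case/negP: (r1 _ erefl); apply: f2; move: lx'; case: (l') => [b|]; lia.
    * case/negP: (r2 _ erefl); apply: f1; move: lx; case: (l) => [b|]; lia.
  + by case/negP: (r1 _ erefl); apply: f2; move: lx'; case: (l') => [b|]; lia.
  + by case/negP: (r2 _ erefl); apply: f1; move: lx; case: (l) => [b|]; lia.
Qed.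

Lemma comp_eq (w : config) c x : is_comp w c -> inc c x -> comp w x = c.
Proof.
move=> cw cx; have [|c1 c2] := @comp_spec w x; first by case: cw => + _ _; exact.
exact: is_comp_inj c1 cw c2 cx.
Qed.

(** Reduces the comparison of lists for two volumes or two configurations to membership; since the
    lists are duplicate-free, this is enough for products. *)
Lemma mem_comps (w : config) L c :
  c \in comps w L <-> is_comp w c /\ exists2 x, x \in barS (barS L) & inc c x.
Proof.
rewrite /comps mem_undup; split=> [/mapP[x]|[cw [x xL cx]]].
  by rewrite mem_filter => /andP[fx xL] ->; have [? ?] := comp_spec fx; split=> //; exists x.
apply/mapP; exists x; last by rewrite (comp_eq cw cx).
by rewrite mem_filter xL andbT; case: cw => + _ _; exact.
Qed.

Lemma minb_le (L : {fset int}) x : x \in barS L -> minb L <= x.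
Proof.
rewrite /minb; elim: (barS L) (head _ _) => // y s IH z.
rewrite inE big_cons => /orP[/eqP ->|xs]; first by rewrite ge_min lexx.
by rewrite ge_min (IH _ xs) orbT.
Qed.

Lemma maxb_ge (L : {fset int}) x : x \in barS L -> x <= maxb L.
Proof.
rewrite /maxb; elim: (barS L) (head _ _) => // y s IH z.
rewrite inE big_cons => /orP[/eqP ->|xs]; first by rewrite le_max lexx.
by rewrite le_max (IH _ xs) orbT.
Qed.

(** The fold is seeded with the head of the list, so it returns a member as soon as the list is
    nonempty. *)
Lemma minb_mem (L : {fset int}) x : x \in barS L -> minb L \in barS L.
Proof.
rewrite /minb; case: (barS L) => // a s _ /=.
have H : forall t, \big[Order.min/a]_(x <- t) x \in a :: t.
  elim=> [|y t IH]; first by rewrite big_nil inE.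
  rewrite big_cons !inE /Order.min; case: ifP => _; first by rewrite eqxx orbT.
  by move: IH; rewrite inE => /orP[->//|->]; rewrite !orbT.
by have := H (a :: s); rewrite !inE => /orP[->|].
Qed.

Lemma maxb_mem (L : {fset int}) x : x \in barS L -> maxb L \in barS L.
Proof.
rewrite /maxb; case: (barS L) => // a s _ /=.
have H : forall t, \big[Order.max/a]_(x <- t) x \in a :: t.
  elim=> [|y t IH]; first by rewrite big_nil inE.
  rewrite big_cons !inE /Order.max; case: ifP => _; last by rewrite eqxx orbT.
  by move: IH; rewrite inE => /orP[->//|->]; rewrite !orbT.
by have := H (a :: s); rewrite !inE => /orP[->|].
Qed.

(** * Dependence of the weights on the spins in a volume *)

Definition agree_off (L : {fset int}) (w w' : config) : Prop :=
  forall x, x \notin L -> w x = w' x.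

Lemma agree_off_sym L w w' : agree_off L w w' -> agree_off L w' w.
Proof. by move=> h x /h. Qed.

Lemma free_agree (L : {fset int}) w w' x : agree_off L w w' -> x \notin barS L ->
  free w x = free w' x.
Proof.
by move=> ww'; rewrite mem_barS !negb_or => /and3P[? ? ?]; rewrite /free !ww'.
Qed.

Definition site (R : realType) (p : R) (w : config) (x : int) : R :=
  if w x then p else if w (x - 1) || w (x + 1) then 1 - p else 1.

(** [site] is 1 at free sites, so one product over [barS L] absorbs both powers in [weight]. *)
Lemma weightE (R : realType) (p : R) L w :
  weight p L w = \prod_(x <- barS L) site p w x * \prod_(c <- comps w L) ZU p L c.
Proof.
rewrite /weight; congr (_ * _); elim: (barS L) => [|x s IH] /=.
  by rewrite big_nil mulr1.
rewrite big_cons -IH /site; case: (w x) => /=.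
  by rewrite add0n add1n exprS mulrA.
by case: (w (x - 1) || w (x + 1)); rewrite ?add0n ?add1n ?exprS ?mul1r // mulrCA.
Qed.

Lemma big_sub_uniq (R : realType) (T : eqType) (s t : seq T) (F : T -> R) :
  uniq s -> uniq t -> {subset s <= t} ->
  \prod_(x <- t) F x = \prod_(x <- s) F x * \prod_(x <- t | x \notin s) F x.
Proof.
move=> us ut st; rewrite (bigID (mem s)) /=; congr (_ * _).
rewrite -big_filter; apply: perm_big; apply: uniq_perm => //.
  exact: filter_uniq.
move=> x; rewrite mem_filter /=; apply/andP/idP => [[]//|xs].
by split=> //; exact: st.
Qed.

Lemma barSS (L D : {fset int}) : (L `<=` D)%fset -> {subset barS L <= barS D}.
Proof. by move=> /fsubsetP LD x; rewrite !mem_barS => /or3P[] /LD ->; rewrite ?orbT. Qed.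

Lemma barbarSS (L D : {fset int}) : (L `<=` D)%fset ->
  {subset barS (barS L) <= barS (barS D)}.
Proof.
move=> LD x; rewrite !(mem_barS (barS _)).
by case/or3P => /(barSS LD) ->; rewrite ?orbT.
Qed.

Lemma compsS (L D : {fset int}) w : (L `<=` D)%fset -> {subset comps w L <= comps w D}.
Proof.
move=> LD c /mem_comps[cw [x /(barbarSS LD) xD cx]].
by apply/mem_comps; split => //; exists x.
Qed.

(* Freeness only changes on [barS L], and the two sites bounding the component
   are not in [barS L] either. *)
Lemma far_comp_agree (L : {fset int}) w w' c : agree_off L w w' ->
  is_comp w c -> (forall x, x \in barS (barS L) -> ~~ inc c x) ->
  (exists x, inc c x) -> is_comp w' c.
Proof.
move=> ww' [f1 l1 r1] far [x0 cx0]; split.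
- move=> y cy; rewrite -(free_agree ww') ?f1 //.
  apply/negP => yL; have /(_ _)/negP := far y; apply; last by [].
  by rewrite mem_barS yL orbT.
- move=> a ca; rewrite -(free_agree ww') ?l1 //.
  apply/negP => yL; have /(_ _)/negP := far a; apply; first by rewrite mem_barS yL.
  move: cx0; rewrite /inc ca lexx /= => /andP[ax]; case: c.2 => // b; lia.
- move=> a ca; rewrite -(free_agree ww') ?r1 //.
  apply/negP => yL; have /(_ _)/negP := far a; apply; first by rewrite mem_barS yL !orbT.
  move: cx0; rewrite /inc ca lexx /= andbT => /andP[+ ax]; case: c.1 => // b; lia.
Qed.

Lemma prod_far (R : realType) (L D : {fset int}) w w' (F : option int * option int -> R) :
  agree_off L w w' ->
  \prod_(c <- comps w D | c \notin comps w L) F c =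
  \prod_(c <- comps w' D | c \notin comps w' L) F c.
Proof.
move=> ww'; rewrite -big_filter -[RHS]big_filter; apply: perm_big; apply: uniq_perm;
  try exact/filter_uniq/undup_uniq.
have H : forall w w' c, agree_off L w w' -> c \in comps w D -> c \notin comps w L ->
   c \in comps w' D /\ c \notin comps w' L.
  move=> {ww'} {}w {}w' c ww' /mem_comps[cw [x xD cx]] cL.
  have far y : y \in barS (barS L) -> ~~ inc c y.
    by move=> yL; apply/negP => cy; case/negP: cL; apply/mem_comps; split=> //; exists y.
  split; first by apply/mem_comps; split; [apply: far_comp_agree ww' cw far _; exists x|exists x].
  by apply/negP => /mem_comps[_ [y /far/negP]].
move=> c; rewrite !mem_filter; apply/andP/andP => -[cL cD].
  by have [] := H _ _ _ ww' cD cL.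
by have [] := H _ _ _ (agree_off_sym ww') cD cL.
Qed.

Lemma prod_at_most_one (R : realType) (T : eqType) (P : pred T) (s : seq T) (k : R) :
  uniq s -> {in s &, forall c c', P c -> P c' -> c = c'} ->
  \prod_(c <- s | P c) k = if has P s then k else 1.
Proof.
elim: s => [|c s IH] /=; first by rewrite big_nil.
move=> /andP[cs us] inj; rewrite big_cons; case: ifP => /= Pc.
  rewrite big1_seq ?mulr1 // => c' /andP[Pc' c's]; case/negP: cs.
  by rewrite (inj c c') ?inE ?eqxx ?c's ?orbT.
by apply: IH => // x y xs ys; apply: inj; rewrite inE ?xs ?ys orbT.
Qed.

Lemma barbar_ge (L : {fset int}) x : x \in barS (barS L) -> minb L - 1 <= x.
Proof. by rewrite mem_barS => /or3P[] /minb_le; lia. Qed.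

Lemma barbar_le (L : {fset int}) x : x \in barS (barS L) -> x <= maxb L + 1.
Proof. by rewrite mem_barS => /or3P[] /maxb_ge; lia. Qed.

(** * Infinite components and the quotient of weights *)

Definition infl (c : option int * option int) : bool := c.1 == None.
Definition infr (c : option int * option int) : bool := c.2 == None.

(** [cnt] is truncated at 0, but a component meeting [barS (barS L)] has right end at least
    [minb L - 1] and left end at most [maxb L + 1], where the untruncated count is exactly 0. So
    enlarging the volume adds the same number of sites to every such component infinite on a given
    side. *)
Lemma ZU_ratio (R : realType) (p : R) (L D : {fset int}) w c :
  (L `<=` D)%fset -> c \in comps w L ->
  ZU p D c = ZU p L c
    * (if infl c then lamPF p ^+ `|minb L - minb D| else 1)
    * (if infr c then lamPF p ^+ `|maxb D - maxb L| else 1).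
Proof.
move=> LD /mem_comps[_ [x xL cx]].
have := barbar_ge xL; have := barbar_le xL => xmax xmin.
have {xL} [y yL] : exists y, y \in barS L.
  by move: xL; rewrite mem_barS => /or3P[] h; [exists (x - 1)|exists x|exists (x + 1)].
have := minb_le (barSS LD (minb_mem yL)).
have := maxb_ge (barSS LD (maxb_mem yL)).
have := minb_le (maxb_mem yL).
rewrite /ZU; move: (minb L) (minb D) (maxb L) (maxb D) xmin xmax => m m' M M' xm xM mM MM' mm'.
case: c cx => [[a|] [b|]]; rewrite /inc /infl /infr /= => cx; rewrite ?mulr1 //.
- by rewrite -mulrA -exprD; congr (_ * _ ^+ _); rewrite /cnt; do 2 case: ifP; lia.
- by rewrite -mulrA -exprD; congr (_ * _ ^+ _); rewrite /cnt; do 2 case: ifP; lia.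
- rewrite -2!(mulrA (_ * Dc p)) -!exprD; congr (_ * _ ^+ _).
  by rewrite /cnt; do 2 case: ifP; lia.
Qed.

(** The criterion reads spins only up to [minb L], a site outside [L], so it is insensitive to the
    spins in [L]. *)
Lemma has_infl (L : {fset int}) w y0 : y0 \in barS L ->
  has infl (comps w L) <-> forall y, y <= minb L - 1 -> free w y.
Proof.
move=> /minb_mem mL; split.
  case/hasP => -[l r] /mem_comps[[f1 _ _] [x /barbar_ge xm]]; rewrite /inc /infl /=.
  move=> + /eqP lE; rewrite {}lE in f1 * => /= xr y ym; apply: f1; rewrite /inc /=.
  by case: r xr => // b; lia.
move=> h; have fx := h _ (lexx _); apply/hasP; exists (comp w (minb L - 1)).
  rewrite mem_undup; apply/mapP; exists (minb L - 1) => //.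
  by rewrite mem_filter fx mem_barS subrK mL !orbT.
have [[_ l1 _]] := comp_spec fx; rewrite /infl /inc.
case: (comp w _).1 l1 => // a /(_ _ erefl)/negP nf /andP[am _]; case: nf.
by apply: h; lia.
Qed.

Lemma has_infr (L : {fset int}) w y0 : y0 \in barS L ->
  has infr (comps w L) <-> forall y, maxb L + 1 <= y -> free w y.
Proof.
move=> /maxb_mem mL; split.
  case/hasP => -[l r] /mem_comps[[f1 _ _] [x /barbar_le xm]]; rewrite /inc /infr /=.
  move=> + /eqP lE; rewrite {}lE in f1 * => /= xr y ym; apply: f1; rewrite /inc /=.
  by case: l xr => // a; lia.
move=> h; have fx := h _ (lexx _); apply/hasP; exists (comp w (maxb L + 1)).
  rewrite mem_undup; apply/mapP; exists (maxb L + 1) => //.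
  by rewrite mem_filter fx mem_barS addrK mL ?orbT.
have [[_ _ l1]] := comp_spec fx; rewrite /infr /inc.
case: (comp w _).2 l1 => // a /(_ _ erefl)/negP nf /andP[_ am]; case: nf.
by apply: h; lia.
Qed.

Lemma has_infl_agree (L : {fset int}) w w' y0 : y0 \in barS L -> agree_off L w w' ->
  has infl (comps w L) = has infl (comps w' L).
Proof.
move=> y0L ww'; have E y : y <= minb L - 1 -> free w y = free w' y.
  by move=> ym; apply: (free_agree ww'); apply/negP => /minb_le; lia.
by apply/idP/idP => /(has_infl _ y0L) h; apply/(has_infl _ y0L) => y ym;
  have := h _ ym; rewrite E.
Qed.

Lemma has_infr_agree (L : {fset int}) w w' y0 : y0 \in barS L -> agree_off L w w' ->
  has infr (comps w L) = has infr (comps w' L).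
Proof.
move=> y0L ww'; have E y : maxb L + 1 <= y -> free w y = free w' y.
  by move=> ym; apply: (free_agree ww'); apply/negP => /maxb_ge; lia.
by apply/idP/idP => /(has_infr _ y0L) h; apply/(has_infr _ y0L) => y ym;
  have := h _ ym; rewrite E.
Qed.

(** Two components unbounded to the left share a point, hence coincide, and the factor occurs at
    most once. *)
Lemma prod_infl (R : realType) (k : R) w L :
  \prod_(c <- comps w L) (if infl c then k else 1) = if has infl (comps w L) then k else 1.
Proof.
rewrite -big_mkcond /= prod_at_most_one ?undup_uniq //.
move=> [l r] [l' r'] /mem_comps[c1 [x _ cx]] /mem_comps[c2 [x' _ cx']].
rewrite /infl /= => /eqP lE /eqP lE'; subst l l'.
apply: (@is_comp_inj w _ _ (Num.min x x')) => //; move: cx cx'; rewrite /inc /=.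
- by case: r {c1} => // b; case: r' {c2} => [b'|]; lia.
- by case: r' {c2} => // b; case: r {c1} => [b'|]; lia.
Qed.

Lemma prod_infr (R : realType) (k : R) w L :
  \prod_(c <- comps w L) (if infr c then k else 1) = if has infr (comps w L) then k else 1.
Proof.
rewrite -big_mkcond /= prod_at_most_one ?undup_uniq //.
move=> [l r] [l' r'] /mem_comps[c1 [x _ cx]] /mem_comps[c2 [x' _ cx']].
rewrite /infr /= => /eqP lE /eqP lE'; subst r r'.
apply: (@is_comp_inj w _ _ (Num.max x x')) => //; move: cx cx'; rewrite /inc /=.
- by case: l {c1} => // b; case: l' {c2} => [b'|]; lia.
- by case: l' {c2} => // b; case: l {c1} => [b'|]; lia.
Qed.

Lemma site_agree (R : realType) (p : R) (L : {fset int}) w w' x : agree_off L w w' ->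
  x \notin barS L -> site p w x = site p w' x.
Proof.
by move=> ww'; rewrite mem_barS !negb_or => /and3P[? ? ?]; rewrite /site !ww'.
Qed.

Lemma agree_off0 w w' : agree_off fset0 w w' -> w = w'.
Proof. by move=> h; apply/funext => x; apply: h; rewrite in_fset0. Qed.

(** The quotient of the two weights is [rho], whose four factors (sites off [barS L], components far
    from [L], left-infinite and right-infinite corrections) all read only spins outside [L].
    Consistency and the Gibbs property both rest on this identity. *)
Lemma weight_cross (R : realType) (p : R) (L D : {fset int}) w w' :
  (L `<=` D)%fset -> agree_off L w w' ->
  weight p D w * weight p L w' = weight p D w' * weight p L w.
Proof.
(* [minb] and [maxb] are meaningful only for nonempty [barS L]; for empty [L] the two configurations
   are equal. *)
move=> LD ww'; have [L0|[y yL]] := fset_0Vmem L.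
  by rewrite L0 in ww'; rewrite (agree_off0 ww').
have {}yL : y \in barS L by rewrite mem_barS yL orbT.
pose rho w := \prod_(x <- barS D | x \notin barS L) site p w x
  * \prod_(c <- comps w D | c \notin comps w L) ZU p D c
  * (if has infl (comps w L) then lamPF p ^+ `|minb L - minb D| else 1)
  * (if has infr (comps w L) then lamPF p ^+ `|maxb D - maxb L| else 1).
have E v : weight p D v = weight p L v * rho v.
  rewrite !weightE (big_sub_uniq _ _ _ (barSS LD)) ?undup_uniq //.
  rewrite (big_sub_uniq _ _ _ (@compsS _ _ v LD)) ?undup_uniq //.
  rewrite (@eq_big_seq _ _ _ _ (comps v L) _ _ (fun c cL => ZU_ratio p LD cL)).
  rewrite !big_split /= prod_infl prod_infr /rho.
  move: (if has infl _ then _ else _) (if has infr _ then _ else _) => k1 k2.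
  by rewrite -!mulrA; congr (_ * _); rewrite mulrCA; do 2 congr (_ * _);
    rewrite mulrA mulrC.
have rhoE : rho w = rho w'.
  rewrite /rho (has_infl_agree yL ww') (has_infr_agree yL ww') (prod_far _ _ ww').
  congr (_ * _ * _ * _); apply: eq_bigr => x; exact: site_agree.
by rewrite !E rhoE; ring.
Qed.

(** * Powers of the transfer matrix and positivity *)

Lemma lamPF_gt0 (R : realType) (p : R) : 0 < p < 1 -> 0 < lamPF p.
Proof.
move=> /andP[p0 p1]; rewrite /lamPF divr_gt0 // ltr_pwDl ?sqrtr_ge0 //; lra.
Qed.

Lemma Qm00S (R : realType) (p : R) n :
  (Qm p ^+ n.+1) 0 0 = (1 - p) * (Qm p ^+ n) 0 0
     + Num.sqrt (p * (1 - p)) * (Qm p ^+ n) 0 1.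
Proof.
rewrite exprSr mxE !big_ord_recl big_ord0 /= addr0.
have -> : lift ord0 ord0 = 1 :> 'I_2 by apply/val_inj.
by rewrite ![Qm p _ _]mxE /= mulrC; congr (_ + _); rewrite mulrC.
Qed.

Lemma Qm01S (R : realType) (p : R) n :
  (Qm p ^+ n.+1) 0 1 = Num.sqrt (p * (1 - p)) * (Qm p ^+ n) 0 0.
Proof.
rewrite exprSr mxE !big_ord_recl big_ord0 /= addr0.
have -> : lift ord0 ord0 = 1 :> 'I_2 by apply/val_inj.
by rewrite ![Qm p _ _]mxE /= mulr0 addr0 mulrC.
Qed.

(** The Cayley-Hamilton relation of [Qm], with trace [1 - p] and determinant [- p * (1 - p)]; it
    removes the square roots. *)
Lemma Qm00_rec (R : realType) (p : R) n : 0 < p < 1 ->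
  (Qm p ^+ n.+2) 0 0 = (1 - p) * (Qm p ^+ n.+1) 0 0 + p * (1 - p) * (Qm p ^+ n) 0 0.
Proof.
move=> /andP[p0 p1]; rewrite Qm00S Qm01S mulrA -expr2 sqr_sqrtr //.
by rewrite mulr_ge0 // ?ltW // subr_gt0.
Qed.

Lemma Qm00_0 (R : realType) (p : R) : (Qm p ^+ 0) 0 0 = 1.
Proof. by rewrite expr0 mxE. Qed.

Lemma Qm00_1 (R : realType) (p : R) : (Qm p ^+ 1) 0 0 = 1 - p.
Proof. by rewrite expr1 mxE. Qed.

Lemma Qm00_gt0 (R : realType) (p : R) n : 0 < p < 1 -> 0 < (Qm p ^+ n) 0 0.
Proof.
move=> hp; have /andP[p0 p1] := hp.
have q0 : 0 < 1 - p by rewrite subr_gt0.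
suff : 0 < (Qm p ^+ n) 0 0 /\ 0 < (Qm p ^+ n.+1) 0 0 by case.
elim: n => [|n [h1 h2]]; first by rewrite Qm00_0 Qm00_1.
by split=> //; rewrite Qm00_rec // addr_gt0 // !mulr_gt0.
Qed.

Lemma ZU_gt0 (R : realType) (p : R) L c : 0 < p < 1 -> 0 < ZU p L c.
Proof.
move=> hp; have l0 := lamPF_gt0 hp; have /andP[p0 p1] := hp.
have q0 : 0 < 1 - p by rewrite subr_gt0.
have D0 : 0 < Dc p.
  by rewrite /Dc divr_gt0 ?exprn_gt0 // mulr_gt0 // addr_gt0 // mulr_gt0.
case: c => [[a|] [b|]] /=; last apply: mulr_gt0; rewrite ?exprn_gt0 //;
  by apply: mulr_gt0; rewrite ?invr_gt0 ?exprn_gt0 ?Qm00_gt0.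
Qed.

Lemma weight_gt0 (R : realType) (p : R) L w : 0 < p < 1 -> 0 < weight p L w.
Proof.
move=> hp; have /andP[p0 p1] := hp.
by rewrite /weight !mulr_gt0 ?exprn_gt0 ?subr_gt0 ?prodr_gt0 // => c _; apply: ZU_gt0.
Qed.

(** * Sigma-algebras of local events *)

Lemma sigma_cylS (D D' : set int) : D `<=` D' -> <<s cyl D >> `<=` <<s cyl D' >>.
Proof.
move=> DD'; apply: smallest_sub; first exact: smallest_sigma_algebra.
move=> A [i [Di iA]]; apply: sub_sigma_algebra; exists i; split => //; exact: DD'.
Qed.

Lemma sigma_cyl_measurable (D : set int) (A : set config) :
  <<s cyl D >> A -> measurable (A : set OmegaM).
Proof. exact: sigma_cylS. Qed.

Lemma sigma_cyl_coord (D : set int) i b : D i -> <<s cyl D >> [set w : config | w i = b].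
Proof. by move=> Di; apply: sub_sigma_algebra; exists i; split => //; exists b. Qed.

Lemma sigma_cyl_preimage (D D' : set int) (f : config -> config) :
  (forall i, D i -> <<s cyl D' >> [set w | f w i]) ->
  forall A, <<s cyl D >> A -> <<s cyl D' >> (f @^-1` A).
Proof.
move=> fD; apply: smallest_sub.
  split.
  - by rewrite /= preimage_set0; apply: (@measurable0 _ (g_sigma_algebraType (cyl D'))).
  - move=> A /= mA; rewrite setTD preimage_setC.
    exact: (@measurableC _ (g_sigma_algebraType (cyl D'))).
  - move=> F mF /=; rewrite preimage_bigcup.
    exact: (@bigcupT_measurable _ (g_sigma_algebraType (cyl D'))).
move=> A [i [Di [b ->]]] /=; case: b; first exact: fD.
have -> : f @^-1` [set w | w i = false] = ~` [set w | f w i].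
  by apply/seteqP; split=> w /=; case: (f w i).
apply: (@measurableC _ (g_sigma_algebraType (cyl D'))); exact: fD.
Qed.

(** The sets that do not separate [v] from [w] form a sigma-algebra containing the generators. *)
Lemma sigma_cyl_local (D : set int) (A : set config) : <<s cyl D >> A ->
  forall v w : config, (forall i, D i -> v i = w i) -> A v -> A w.
Proof.
move=> mA v w vw; suff : A v <-> A w by case.
pose S := [set A : set config | A v <-> A w].
have : <<s cyl D >> `<=` S.
  apply: smallest_sub; first split.
  - by split.
  - by move=> B [h1 h2]; split=> -[_ nB]; split=> // h; apply: nB; auto.
  - by move=> F hF; split=> -[n _ Fn]; exists n => //; apply/hF.
  by move=> B [i [Di [b ->]]]; split=> /=; rewrite vw.
exact.
Qed.

(** Erasing the spins outside [D] does not affect membership in [A], and the erased configuration is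
    measurable with respect to [D]. Local measurability thus splits into plain measurability and a
    dependence check. *)
Lemma sigma_cyl_of_local (D : set int) (A : set config) : measurable (A : set OmegaM) ->
  (forall v w : config, (forall i, D i -> v i = w i) -> A v -> A w) -> <<s cyl D >> A.
Proof.
move=> mA loc; pose f (w : config) : config := fun i => w i && `[< D i >].
have -> : A = f @^-1` A.
  apply/seteqP; split=> w; apply: loc => i Di;
  by rewrite /f (asboolT Di) andbT.
apply: (@sigma_cyl_preimage setT) => // i _; rewrite /f.
have [Di|nDi] := pselect (D i).
  rewrite (asboolT Di); under eq_set do rewrite andbT; exact: sigma_cyl_coord.
rewrite (asboolF nDi); under eq_set do rewrite andbF.
have -> : [set _ : config | false] = set0 by apply/seteqP; split.
exact: (@measurable0 _ (g_sigma_algebraType (cyl D))).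
Qed.

(** * Countably valued measurable maps *)

(** Factorization through a countable type with measurable fibres. Every subset of [U] then has a
    measurable preimage, with no sigma-algebra on [U], and composition with an arbitrary function
    stays in the class. Components, lists of components and weights are all of this kind. *)
Definition cmeas (U : Type) (h : config -> U) : Prop :=
  exists (T : countType) (f : config -> T) (g : T -> U),
    (forall y, measurable ([set w | f w = y] : set OmegaM)) /\ forall w, h w = g (f w).

Lemma countType_preimage (T : countType) (f : config -> T) (P : set T) :
  (forall y, measurable ([set w | f w = y] : set OmegaM)) ->
  measurable ([set w | P (f w)] : set OmegaM).
Proof.
move=> mf; have -> : [set w | P (f w)] = \bigcup_n
    (if @choice.unpickle T n is Some y
     then if `[< P y >] then [set w | f w = y] else set0 else set0).
  apply/seteqP; split=> w /=.
    by move=> Pw; exists (choice.pickle (f w)) => //; rewrite choice.pickleK asboolT.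
  by case=> n _; case: (@choice.unpickle T n) => // y; case: asboolP => // Py /= ->.
apply: bigcupT_measurable => n; case: (@choice.unpickle T n) => // y.
by case: ifP => // _; exact: measurable0.
Qed.

Lemma cmeas_preimage U (h : config -> U) (P : set U) :
  cmeas h -> measurable ([set w | P (h w)] : set OmegaM).
Proof.
case=> T [f [g [mf hE]]]; under eq_set do rewrite hE.
exact: (@countType_preimage T f (fun y => P (g y))).
Qed.

Lemma cmeas_comp U V (g : U -> V) (h : config -> U) : cmeas h -> cmeas (fun w => g (h w)).
Proof.
by case=> T [f [g' [mf hE]]]; exists T, f, (g \o g'); split=> // w; rewrite /= hE.
Qed.

Lemma cmeas_ext U (h h' : config -> U) : h =1 h' -> cmeas h -> cmeas h'.
Proof. by move=> /funext ->. Qed.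

Lemma cmeas_pair U V (h : config -> U) (k : config -> V) :
  cmeas h -> cmeas k -> cmeas (fun w => (h w, k w)).
Proof.
case=> T [f [g [mf hE]]] [T' [f' [g' [mf' kE]]]].
exists (T * T')%type, (fun w => (f w, f' w)), (fun x => (g x.1, g' x.2)).
split=> [[y y']|w]; last by rewrite hE kE.
have -> : [set w | (f w, f' w) = (y, y')] = [set w | f w = y] `&` [set w | f' w = y'].
  by apply/seteqP; split=> w /= [-> ->].
exact: measurableI.
Qed.

Lemma cmeas_cst U (u : U) : cmeas (fun=> u).
Proof.
exists unit, (fun=> tt), (fun=> u); split=> // -[].
have -> : [set _ : config | tt = tt] = setT by apply/seteqP; split.
exact: measurableT.
Qed.

Lemma cmeas_asbool (P : config -> Prop) : measurable ([set w | P w] : set OmegaM) ->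
  cmeas (fun w => `[< P w >]).
Proof.
move=> mP; exists bool, (fun w => `[< P w >]), id; split=> // -[].
  by have -> : [set w | `[< P w >] = true] = [set w | P w] by
    apply/seteqP; split=> w /= /asboolP.
have -> : [set w | `[< P w >] = false] = ~` [set w | P w].
  by apply/seteqP; split=> w /=; [move/asboolP|move=> h; apply/asboolP].
exact: measurableC.
Qed.

Lemma cmeas_coord i : cmeas (fun w => w i).
Proof. by exists bool, (fun w => w i), id; split=> // y; exact: sigma_cyl_coord. Qed.

Lemma cmeas_map U V (s : seq V) (F : V -> config -> U) :
  (forall x, cmeas (F x)) -> cmeas (fun w => [seq F x w | x <- s]).
Proof.
move=> mF; elim: s => [|x s IH] /=; first exact: cmeas_cst.
exact: (cmeas_comp (fun q => q.1 :: q.2) (cmeas_pair (mF x) IH)).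
Qed.

(** Through the list of pairs (condition, value), the sum becomes a fixed function of a countably
    valued list. *)
Lemma cmeas_sum (R : realType) V (s : seq V) (P : V -> config -> bool)
    (F : V -> config -> R) : (forall x, cmeas (P x)) -> (forall x, cmeas (F x)) ->
  cmeas (fun w => \sum_(x <- s | P x w) F x w).
Proof.
move=> mP mF.
apply: (@cmeas_ext _ (fun w => \sum_(q <- [seq (P x w, F x w) | x <- s] | q.1) q.2)).
  by move=> w; rewrite big_map.
apply: (cmeas_comp (fun t : seq (bool * R) => \sum_(q <- t | q.1) q.2)).
by apply: cmeas_map => x; exact: cmeas_pair.
Qed.

(** The search common to [lend] and [rend], so that one measurability proof serves both
    endpoints. *)
Definition first_hit (P : nat -> bool) : option nat :=
  match pselect (exists n, P n) with left h => Some (ex_minn h) | right _ => None end.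

Lemma cmeas_first_hit (P : config -> nat -> bool) :
  (forall n, cmeas (fun w => P w n)) -> cmeas (fun w => first_hit (P w)).
Proof.
move=> mP; exists (option nat), (fun w => first_hit (P w)), id; split=> //.
have mb n b : measurable ([set w | P w n = b] : set OmegaM).
  exact: (cmeas_preimage (fun x => x = b)).
case=> [n|].
  have -> : [set w | first_hit (P w) = Some n] =
      [set w | P w n = true] `&` \bigcap_(m in [set m | (m < n)%N]) [set w | P w m = false].
    apply/seteqP; split=> w /=; rewrite /first_hit; case: pselect => // h.
    - case: ex_minnP => m Pm mmin [<-]; split=> // k /= km.
      by apply/negP => /mmin; lia.
    - case: ex_minnP => m Pm mmin [Pn nP]; congr Some; apply/eqP.
      rewrite eqn_leq mmin //= leqNgt; apply/negP => mn.
      by have := nP m mn; rewrite /= Pm.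
    - by case=> Pn; case: h; exists n.
  by apply: measurableI => //; apply: bigcap_measurableType.
have -> : [set w | first_hit (P w) = None] = \bigcap_n [set w | P w n = false].
  apply/seteqP; split=> w /=; rewrite /first_hit; case: pselect => // h.
  - by move=> _ n _ /=; apply/negP => Pn; case: h; exists n.
  - by case: h => n Pn /(_ n Logic.I) /=; rewrite Pn.
by apply: bigcap_measurableType.
Qed.

(** * Measurability of components, weights and kernels *)

Lemma cmeas_free x : cmeas (fun w => free w x).
Proof.
exact: (cmeas_comp (fun q : bool * bool * bool => ~~ q.1.1 && ~~ q.1.2 && ~~ q.2)
  (cmeas_pair (cmeas_pair (cmeas_coord (x - 1)) (cmeas_coord x)) (cmeas_coord (x + 1)))).
Qed.

Lemma cmeas_component x : cmeas (fun w => comp w x).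
Proof.
apply: cmeas_pair.
- apply: (@cmeas_ext _ (fun w => omap (fun n : nat => x - n%:Z + 1)
    (first_hit (fun n => ~~ free w (x - n%:Z))))).
    by move=> w; rewrite /lend /first_hit; case: pselect.
  apply: cmeas_comp; apply: cmeas_first_hit => n.
  exact: (cmeas_comp negb (cmeas_free _)).
- apply: (@cmeas_ext _ (fun w => omap (fun n : nat => x + n%:Z - 1)
    (first_hit (fun n => ~~ free w (x + n%:Z))))).
    by move=> w; rewrite /rend /first_hit; case: pselect.
  apply: cmeas_comp; apply: cmeas_first_hit => n.
  exact: (cmeas_comp negb (cmeas_free _)).
Qed.

Lemma cmeas_comps L : cmeas (fun w => comps w L).
Proof.
apply: (cmeas_comp (@undup _)).
apply: (@cmeas_ext _ (fun w => [seq q.2 | q <- [seq (free w x, comp w x) |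
    x <- barS (barS L)] & q.1])).
  by move=> w; elim: (barS _) => //= x s; case: (free w x) => /= ->.
apply: (cmeas_comp (fun t : seq (bool * _) => [seq q.2 | q <- t & q.1])).
by apply: cmeas_map => x; apply: cmeas_pair; [exact: cmeas_free|exact: cmeas_component].
Qed.

Lemma cmeas_site (R : realType) (p : R) x : cmeas (fun w => site p w x).
Proof.
exact: (cmeas_comp (fun q : bool * bool * bool =>
    if q.2 then p else if q.1.1 || q.1.2 then 1 - p else 1)
  (cmeas_pair (cmeas_pair (cmeas_coord (x - 1)) (cmeas_coord (x + 1))) (cmeas_coord x))).
Qed.

Lemma cmeas_weight (R : realType) (p : R) L : cmeas (weight p L).
Proof.
apply: (@cmeas_ext _ (fun w => \prod_(r <- [seq site p w x | x <- barS L]) r *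
   \prod_(c <- comps w L) ZU p L c)).
  by move=> w; rewrite weightE big_map.
exact: (cmeas_comp
  (fun q : seq R * seq _ => \prod_(r <- q.1) r * \prod_(c <- q.2) ZU p L c)
  (cmeas_pair (cmeas_map (barS L) (fun x => cmeas_site p x)) (cmeas_comps L))).
Qed.

Lemma measurable_Omega' : measurable (Omega' : set OmegaM).
Proof.
pose E x := [set w : config | w x ==> (w (x - 1) || w (x + 1))].
have mE x : measurable (E x : set OmegaM).
  apply: (cmeas_preimage (fun b : bool => b)).
  exact: (cmeas_comp (fun q : bool * bool * bool => q.2 ==> (q.1.1 || q.1.2))
  (cmeas_pair (cmeas_pair (cmeas_coord (x - 1)) (cmeas_coord (x + 1))) (cmeas_coord x))).
have -> : Omega' = \bigcap_(n : nat) (E n%:Z `&` E (- n%:Z)).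
  apply/seteqP; split=> w.
    by move/Omega'P => h n _; split; apply/implyP/h.
  move=> h; apply/Omega'P => x wx; have [h1 h2] := h `|x|%N Logic.I.
  have [x0|x0] := lerP 0 x.
    by move: h1; rewrite /E /= gez0_abs // wx.
  by move: h2; rewrite /E /= ltz0_abs // opprK wx.
by apply: bigcap_measurableType => n _; exact: measurableI.
Qed.

Lemma glueE (L : {fset int}) (xi : {ffun L -> bool}) w x :
  glue xi w x = if insub x is Some j then xi j else w x.
Proof. by []. Qed.

Lemma glue_out (L : {fset int}) (xi : {ffun L -> bool}) w x :
  x \notin L -> glue xi w x = w x.
Proof. by move=> xL; rewrite glueE insubN. Qed.

Lemma glue_in (L : {fset int}) (xi : {ffun L -> bool}) w (j : L) :
  glue xi w (fsval j) = xi j.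
Proof. by rewrite glueE valK. Qed.

(** Each coordinate of [glue xi w] is a constant in [L] and a spin of [w] outside [L]. *)
Lemma glue_sigma (L : {fset int}) (xi : {ffun L -> bool}) (A : set config) :
  measurable (A : set OmegaM) -> <<s cyl (Lc L) >> (glue xi @^-1` A).
Proof.
apply: (@sigma_cyl_preimage setT) => i _; have [iL|iL] := boolP (i \in L).
  rewrite (_ : [set _ | _] = if xi [` iL]%fset then setT else set0).
    case: ifP => _; first exact: (@measurableT _ (g_sigma_algebraType (cyl (Lc L)))).
    exact: (@measurable0 _ (g_sigma_algebraType (cyl (Lc L)))).
  have E w : glue xi w i = xi [` iL]%fset by rewrite -(glue_in xi w [` iL]%fset).
  by apply/seteqP; split=> w /=; rewrite E; case: (xi _).
under eq_set do rewrite glue_out //; exact: sigma_cyl_coord.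
Qed.

Lemma cmeas_glue U (h : config -> U) (L : {fset int}) (xi : {ffun L -> bool}) :
  cmeas h -> cmeas (fun w => h (glue xi w)).
Proof.
case=> T [f [g [mf hE]]]; exists T, (fun w => f (glue xi w)), g; split=> // y.
exact: (sigma_cyl_measurable (glue_sigma xi (mf y))).
Qed.

Lemma F'_measurable B : F' B -> measurable (B : set OmegaM).
Proof. by case=> A [mA ->]; apply: measurableI => //; exact: measurable_Omega'. Qed.

Lemma cmeas_glue_asbool (L : {fset int}) (xi : {ffun L -> bool}) (A : set config) :
  measurable (A : set OmegaM) -> cmeas (fun w => `[< A (glue xi w) >]).
Proof.
by move=> mA; apply: (cmeas_glue (h := fun w => `[< A w >])); exact: cmeas_asbool.
Qed.

Lemma cmeas_gammaP (R : realType) (p : R) L B : measurable (B : set OmegaM) ->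
  cmeas (fun w => gammaP p L w B).
Proof.
move=> mB; have mO := measurable_Omega'.
have mW (xi : {ffun L -> bool}) := cmeas_glue xi (cmeas_weight p L).
have mOB (xi : {ffun L -> bool}) :
    cmeas (fun w => `[< Omega' (glue xi w) >] && `[< B (glue xi w) >]).
  exact: (cmeas_comp (fun q : bool * bool => q.1 && q.2)
    (cmeas_pair (cmeas_glue_asbool xi mO) (cmeas_glue_asbool xi mB))).
have m1 := cmeas_sum (index_enum _) mOB mW.
have m2 := cmeas_sum (index_enum _) (fun xi => cmeas_glue_asbool xi mO) mW.
exact: (cmeas_comp (fun q : R * R => q.1 / q.2) (cmeas_pair m1 m2)).
Qed.

(** * The specification *)

Definition restr (L : {fset int}) (w : config) : {ffun L -> bool} :=
  [ffun j => w (fsval j)].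

Lemma glue_restr (L : {fset int}) w v : agree_off L w v -> glue (restr L v) w = v.
Proof.
move=> wv; apply/funext => x; have [xL|xL] := boolP (x \in L).
  by rewrite -[x]/(fsval [` xL]%fset) glue_in ffunE.
by rewrite glue_out // wv.
Qed.

Lemma restr_glue (L : {fset int}) (xi : {ffun L -> bool}) w : restr L (glue xi w) = xi.
Proof. by apply/ffunP => j; rewrite ffunE glue_in. Qed.

Lemma glue_agree (L : {fset int}) (xi : {ffun L -> bool}) w : agree_off L (glue xi w) w.
Proof. by move=> x xL; rewrite glue_out. Qed.

Lemma glue_local (L : {fset int}) (xi : {ffun L -> bool}) v w :
  agree_off L v w -> glue xi v = glue xi w.
Proof.
move=> vw; apply/funext => x; have [xL|xL] := boolP (x \in L).
  by rewrite -[x]/(fsval [` xL]%fset) !glue_in.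
by rewrite !glue_out // vw.
Qed.

Lemma ZL_agree (R : realType) (p : R) (L : {fset int}) v w :
  agree_off L v w -> ZL p L v = ZL p L w.
Proof.
by move=> vw; rewrite /ZL; apply: eq_big => [xi|xi _]; rewrite (glue_local _ vw).
Qed.

Lemma gammaP_agree (R : realType) (p : R) (L : {fset int}) v w B :
  agree_off L v w -> gammaP p L v B = gammaP p L w B.
Proof.
move=> vw; rewrite /gammaP (ZL_agree _ vw); congr (_ / _).
by apply: eq_big => [xi|xi _]; rewrite (glue_local _ vw).
Qed.

Lemma ZL_gt0 (R : realType) (p : R) (L : {fset int}) w :
  0 < p < 1 -> Omega' w -> 0 < ZL p L w.
Proof.
move=> hp Ow; have E : glue (restr L w) w = w by exact: glue_restr.
rewrite /ZL (bigD1 (restr L w)) /=; last by rewrite E asboolT.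
apply: ltr_pwDl; first exact: weight_gt0.
by apply: sumr_ge0 => xi _; apply/ltW/weight_gt0.
Qed.

(** The kernel is a finite combination of Dirac masses at the configurations [glue xi w]; the value
    0 at inadmissible [xi] lets sums run over all of [{ffun L -> bool}]. *)
Definition mass (R : realType) (p : R) (L : {fset int}) (w : config) (xi : {ffun L -> bool}) : R :=
  if `[< Omega' (glue xi w) >] then weight p L (glue xi w) / ZL p L w else 0.

Lemma gammaP_mass (R : realType) (p : R) (L : {fset int}) w B :
  gammaP p L w B = \sum_(xi : {ffun L -> bool}) mass p w xi * \1_B (glue xi w).
Proof.
rewrite /gammaP mulr_suml big_mkcond /=; apply: eq_bigr => xi _.
rewrite /mass indicE; case: asboolP => _ /=; last by rewrite mul0r.
case: asboolP => BX; first by rewrite mem_set // mulr1.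
by rewrite memNset // mulr0.
Qed.

Lemma mass_ge0 (R : realType) (p : R) (L : {fset int}) w (xi : {ffun L -> bool}) :
  0 < p < 1 -> Omega' w -> 0 <= mass p w xi.
Proof.
move=> hp Ow; rewrite /mass; case: ifP => // _.
by rewrite divr_ge0 // ltW ?weight_gt0 ?ZL_gt0.
Qed.

Lemma sum_mass (R : realType) (p : R) (L : {fset int}) w :
  0 < p < 1 -> Omega' w -> \sum_(xi : {ffun L -> bool}) mass p w xi = 1.
Proof.
move=> hp Ow; rewrite /mass -big_mkcond /= -mulr_suml divff //.
by rewrite gt_eqF // ZL_gt0.
Qed.

Lemma gammaP_ge0 (R : realType) (p : R) (L : {fset int}) w B :
  0 < p < 1 -> Omega' w -> 0 <= gammaP p L w B.
Proof.
move=> hp Ow; rewrite gammaP_mass; apply: sumr_ge0 => xi _.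
by rewrite mulr_ge0 ?mass_ge0 // indicE.
Qed.

Lemma cvg_sum_indic (R : realType) (Bn : nat -> set config) (v : config) :
  trivIset setT Bn ->
  (fun N : nat => \sum_(n < N) \1_(Bn n) v : R) @ \oo --> (\1_(\bigcup_n Bn n) v : R).
Proof.
move=> tB; have [[k _ Bk]|nB] := pselect ((\bigcup_n Bn n) v); last first.
  rewrite indicE memNset //; apply: cvg_near_cst; near=> N.
  rewrite big1 // => n _; rewrite indicE memNset // => Bv.
  by apply: nB; exists n.
rewrite indicE mem_set; last by exists k.
apply: cvg_near_cst; near=> N.
have kN : (k < N)%N by near: N; exists k.+1.
rewrite (bigD1 (Ordinal kN)) //= indicE mem_set // big1 ?addr0 // => n nk.
rewrite indicE memNset // => Bv; case/negP: nk; apply/eqP/val_inj => /=.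
by apply: tB => //; exists v.
Unshelve. all: by end_near.
Qed.

Lemma gammaP_prob (R : realType) (p : R) (L : {fset int}) w :
  0 < p < 1 -> Omega' w -> prob_on_trace (gammaP p L w).
Proof.
move=> hp Ow; split.
- by move=> B _; exact: gammaP_ge0.
- rewrite gammaP_mass -(sum_mass L hp Ow); apply: eq_bigr => xi _.
  rewrite /mass; case: asboolP => O; last by rewrite mul0r.
  by rewrite indicE mem_set // mulr1.
- move=> Bn _ tB; rewrite gammaP_mass.
  have -> : (fun N : nat => \sum_(n < N) gammaP p L w (Bn n)) =
    \sum_(xi : {ffun L -> bool})
       (fun N : nat => mass p w xi * \sum_(n < N) \1_(Bn n) (glue xi w)).
    apply/funext => N; rewrite fct_sumE; under eq_bigr do rewrite gammaP_mass.
    by rewrite exchange_big /=; apply: eq_bigr => xi _; rewrite mulr_sumr.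
  apply: (big_ind2 (fun (f : nat -> R) (l : R) => f @ \oo --> l)) => [|f1 l1 f2 l2|xi _].
  - exact: cvg_cst.
  - exact: cvgD.
  apply: cvgM; first exact: cvg_cst.
  exact: cvg_sum_indic.
Qed.

Lemma gammaP_trace_measurable (R : realType) (p : R) (L : {fset int}) B : F' B ->
  trace_measurable <<s cyl (Lc L) >> (fun w => gammaP p L w B).
Proof.
move=> /F'_measurable mB Y mY; exists [set w | Y (gammaP p L w B)]; split => //.
apply: sigma_cyl_of_local; first exact: (cmeas_preimage Y (cmeas_gammaP p L mB)).
by move=> v w vw; rewrite /= (gammaP_agree _ _ vw).
Qed.

(** Resampling in [L] does not affect an event read off outside [L], so the indicator leaves the sum
    and the masses add up to 1. *)
Lemma gammaP_proper (R : realType) (p : R) (L : {fset int}) B w : 0 < p < 1 ->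
  F'_ (Lc L) B -> Omega' w -> gammaP p L w B = \1_B w.
Proof.
move=> hp [A [mA ->]] Ow; rewrite gammaP_mass -[RHS]mul1r -(sum_mass L hp Ow) mulr_suml.
apply: eq_bigr => xi _; rewrite /mass; case: asboolP => O; last by rewrite !mul0r.
congr (_ * _); rewrite !indicE; congr (_%:R); congr nat_of_bool.
have gw := @glue_agree L xi w.
have E : A (glue xi w) <-> A w.
  by split; apply: (sigma_cyl_local mA) => i iL; [exact: gw|rewrite gw].
by apply/idP/idP; rewrite !inE => -[_ /E].
Qed.

(** The set function is identified with a finite sum of scaled Dirac measures, which carries the
    measure structure that the integration lemmas require. *)
Lemma integral_finite_dirac (R : realType) (T : finType) (i0 : T) (c : T -> R)
    (x : T -> OmegaM) (D : set OmegaM) (f : OmegaM -> \bar R) :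
  (forall i, 0 <= c i) -> measurable D -> measurable_fun D f ->
  (forall v, D v -> (0 <= f v)%E) ->
  (\int[fun A : set OmegaM => (\sum_i c i * \1_A (x i))%:E]_(v in D) f v =
   \sum_i (c i)%:E * (\d_(x i) D * f (x i)))%E.
Proof.
move=> c0 mD mf f0.
pose i_ n := nth i0 (index_enum T) n.
pose m_ n : {measure set OmegaM -> \bar R} := mscale (NngNum (c0 (i_ n))) \d_(x (i_ n)).
have -> : (fun A : set OmegaM => (\sum_i c i * \1_A (x i))%:E) =
    msum m_ (size (index_enum T)).
  apply/funext => A; rewrite /msum -sumEFin (big_nth i0) big_mkord.
  by apply: eq_bigr => i _; rewrite /m_ /= /mscale /= EFinM.
rewrite ge0_integral_measure_sum // [RHS](big_nth i0) big_mkord.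
by apply: eq_bigr => i _; rewrite ge0_integral_mscale // integral_dirac.
Qed.

(** A term is indexed by two configurations that agree with [w] off [D] and with each other off [L];
    exchanging them is an involution [h] of the index pairs. *)
Lemma sum_glue_swap (R : realType) (L D : {fset int}) (w : config)
    (f : config -> config -> R) : (L `<=` D)%fset ->
  \sum_(xi : {ffun D -> bool}) \sum_(eta : {ffun L -> bool})
     f (glue xi w) (glue eta (glue xi w)) =
  \sum_(xi : {ffun D -> bool}) \sum_(eta : {ffun L -> bool})
     f (glue eta (glue xi w)) (glue xi w).
Proof.
move=> /fsubsetP LD; rewrite !pair_big /=.
pose h (q : {ffun D -> bool} * {ffun L -> bool}) :=
  (restr D (glue q.2 (glue q.1 w)), restr L (glue q.1 w)).
have E1 q : glue (h q).1 w = glue q.2 (glue q.1 w).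
  apply: glue_restr => x xD; rewrite !glue_out //.
  by apply: contra xD => /LD.
have E2 q : glue (h q).2 (glue (h q).1 w) = glue q.1 w.
  by rewrite E1; apply: glue_restr; exact: glue_agree.
have hK : involutive h.
  by move=> q; rewrite [LHS]/h E2 E1 !restr_glue; case: q.
rewrite (reindex_inj (inv_inj hK)) /=.
by apply: eq_bigr => q _; rewrite E2 E1.
Qed.

Lemma sum_mass_gammaP (R : realType) (p : R) (L D : {fset int}) w B :
  0 < p < 1 -> (L `<=` D)%fset -> Omega' w ->
  \sum_(xi : {ffun D -> bool}) mass p w xi * gammaP p L (glue xi w) B = gammaP p D w B.
Proof.
move=> hp LD Ow.
pose o (v : config) : R := (`[< Omega' v >])%:R.
have massE (L' : {fset int}) v (xi : {ffun L' -> bool}) :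
    mass p v xi = o (glue xi v) * weight p L' (glue xi v) / ZL p L' v.
  by rewrite /mass /o; case: ifP => _; rewrite ?mul1r ?mul0r.
pose f v u : R := o v * weight p D v / ZL p D w *
  (o u * weight p L u / ZL p L v * \1_B u).
transitivity (\sum_(xi : {ffun D -> bool}) \sum_(eta : {ffun L -> bool})
     f (glue xi w) (glue eta (glue xi w))).
  apply: eq_bigr => xi _; rewrite gammaP_mass mulr_sumr; apply: eq_bigr => eta _.
  by rewrite !massE.
rewrite sum_glue_swap // gammaP_mass; apply: eq_bigr => xi _.
rewrite massE; set v := glue xi w; rewrite {1}/o; case: asboolP => Ov; last first.
  by rewrite !mul0r big1 // => eta _; rewrite /f /o (asboolF Ov) !mul0r mulr0.
(* The factor 1 is expanded as the total mass of the inner kernel at [v], so that [weight_cross]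
   matches the two sides term by term. *)
rewrite mul1r -[RHS]mulr1 -[X in _ = _ * X](sum_mass L hp Ov) mulr_sumr; apply: eq_bigr => eta _.
have gv := @glue_agree L eta v.
rewrite /f massE (ZL_agree _ gv) {2}/o (asboolT Ov).
set u := glue eta v in gv *.
have C := weight_cross p LD gv.
transitivity (weight p D u * weight p L v * (o u / ZL p D w / ZL p L v * \1_B v)).
  by rewrite !mul1r; ring.
by rewrite C; ring.
Qed.

Lemma gammaP_consistent (R : realType) (p : R) (L D : {fset int}) w B :
  0 < p < 1 -> (L `<=` D)%fset -> Omega' w -> F' B ->
  (\int[fun A : set OmegaM => (gammaP p D w (Omega' `&` A))%:E]_(v in Omega')
     (gammaP p L v B)%:E)%E = (gammaP p D w B)%:E.
Proof.
move=> hp LD Ow FB; have mB := F'_measurable FB.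
have -> : (fun A : set OmegaM => (gammaP p D w (Omega' `&` A))%:E) =
   (fun A : set OmegaM => (\sum_(xi : {ffun D -> bool}) mass p w xi * \1_A (glue xi w))%:E).
  apply/funext => A; rewrite gammaP_mass; congr (_%:E); apply: eq_bigr => xi _.
  rewrite /mass; case: asboolP => O; last by rewrite !mul0r.
  by rewrite indicI /= indicE mem_set // mul1r.
rewrite integral_finite_dirac //.
- rewrite -(sum_mass_gammaP B hp LD Ow) -sumEFin; apply: eq_bigr => xi _.
  rewrite /mass; case: asboolP => O; last by rewrite mul0e mul0r.
  by rewrite diracE mem_set // mul1e -EFinM.
- exact: [ffun=> false].
- by move=> xi; exact: mass_ge0.
- exact: measurable_Omega'.
- apply: (measurable_funS measurableT) => //; apply/measurable_EFinP => _ Y mY.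
  by rewrite setTI; exact: (cmeas_preimage Y (cmeas_gammaP p L mB)).
- by move=> v Ov; rewrite lee_fin; exact: gammaP_ge0.
Qed.

Lemma gammaP_specification (R : realType) (p : R) : 0 < p < 1 ->
  is_specification (gammaP p).
Proof.
move=> hp; split.
- by move=> L w; exact: gammaP_prob.
- by move=> L B; exact: gammaP_trace_measurable.
- by move=> L B LB w; exact: gammaP_proper.
- by move=> L D LD w Ow B; exact: gammaP_consistent.
Qed.

(** * Independence under the Bernoulli product measure *)

Definition cylF (F : {fset int}) (eta : config) : set config :=
  [set w | forall i, i \in F -> w i = eta i].

(** The empty set is included because two cylinders may contradict each other; the class is then a
    pi-system. *)
Definition picyl (D : set int) : set (set config) :=
  [set A | A = set0 \/ exists F eta, (forall i, i \in F -> D i) /\ A = cylF F eta].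

Lemma cylF_sigma (D : set int) (F : {fset int}) eta :
  (forall i, i \in F -> D i) -> <<s cyl D >> (cylF F eta).
Proof.
move=> FD; apply: sigma_cyl_of_local; last first.
  by move=> v w vw h i iF; rewrite -vw ?h //; exact: FD.
have -> : cylF F eta = [set w | [seq w i | i <- F] = [seq eta i | i <- F]].
  by apply/seteqP; split=> w /= /eq_in_map.
apply: (cmeas_preimage (fun t => t = [seq eta i | i <- F])).
by apply: cmeas_map; exact: cmeas_coord.
Qed.

Lemma picyl_setI (D : set int) : setI_closed (picyl D).
Proof.
move=> A B [->|[F [eta [FD ->]]]]; first by rewrite set0I; left.
move=> [->|[F' [eta' [FD' ->]]]]; first by rewrite setI0; left.
have [[w0 [w1 w2]]|nw] := pselect (exists w, (cylF F eta `&` cylF F' eta') w); last first.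
  by left; apply/seteqP; split=> w // ww; case: nw; exists w.
right; exists (F `|` F')%fset, w0; split.
  by move=> i; rewrite in_fsetU => /orP[/FD|/FD'].
apply/seteqP; split=> w.
  by move=> [h1 h2] i; rewrite in_fsetU => /orP[iF|iF]; [rewrite h1 // w1|rewrite h2 // w2].
by move=> h; split=> i iF; rewrite h ?in_fsetU ?iF ?orbT //; [rewrite w1|rewrite w2].
Qed.

Lemma sigma_picyl (D : set int) : <<s cyl D >> `<=` <<s picyl D >>.
Proof.
apply: smallest_sub; first exact: smallest_sigma_algebra.
move=> A [i [Di [b ->]]]; apply: sub_sigma_algebra; right.
exists [fset i]%fset, (fun=> b); split; first by move=> j /fset1P ->.
by apply/seteqP; split=> w /=; [move=> <- j /fset1P ->|apply; rewrite fset11].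
Qed.

(** Both sides are finite measures in [S], the restriction of [mu] to [S'] and a multiple of [mu];
    they agree on the pi-system [picyl D]. *)
Lemma indep_extend (R : realType) (mu : probability OmegaM R) (D : set int)
    (S' : set config) : measurable (S' : set OmegaM) ->
  (forall F eta, (forall i, i \in F -> D i) ->
     mu (cylF F eta `&` S') = (mu (cylF F eta) * mu S')%E) ->
  forall S, <<s cyl D >> S -> mu (S `&` S') = (mu S * mu S')%E.
Proof.
move=> mS' hF S mS.
have fS' : mu S' \is a fin_num by exact: fin_num_measure.
have S'0 : 0 <= fine (mu S') by rewrite fine_ge0.
pose m1 : {measure set OmegaM -> \bar R} := mrestr mu mS'.
pose m2 : {measure set OmegaM -> \bar R} := mscale (NngNum S'0) mu.
suff : m1 S = m2 S.
  by rewrite /m1 /m2 /= /mrestr /mscale /= fineK // muleC.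
apply: (@g_sigma_algebra_measure_unique _ R OmegaM (picyl D) _ (fun=> setT)) => //.
- move=> A [->|[F [eta [FD ->]]]]; first exact: measurable0.
  exact: (sigma_cyl_measurable (cylF_sigma eta FD)).
- by move=> _; right; exists fset0, (fun=> false); split => //; apply/seteqP; split.
- by rewrite bigcup_const //; exists 0%N.
- exact: picyl_setI.
- move=> A [->|[F [eta [FD ->]]]]; first by rewrite !measure0.
  by rewrite /m1 /m2 /= /mrestr /mscale /= fineK // hF // muleC.
- move=> _; rewrite /m1 /= /mrestr setTI.
  by rewrite ltey_eq fS'.
- exact: sigma_picyl.
Qed.

Lemma bernoulli_indep (R : realType) (p : R) (mu : probability OmegaM R)
    (D D' : set int) (S S' : set config) : is_bernoulli_product p mu ->
  (forall i, D i -> D' i -> False) -> <<s cyl D >> S -> <<s cyl D' >> S' ->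
  mu (S `&` S') = (mu S * mu S')%E.
Proof.
move=> hmu DD' mS mS'; apply: (indep_extend (D := D)) mS => //.
  exact: sigma_cyl_measurable mS'.
(* The extension is applied again with the roles exchanged, which leaves two finite cylinders on
   disjoint sites. *)
move=> F eta FD; rewrite setIC muleC.
apply: (indep_extend (D := D')) mS'.
  exact: (sigma_cyl_measurable (cylF_sigma eta FD)).
move=> F' eta' FD'.
have disj : forall i, i \in F' -> i \notin F.
  by move=> i /FD' D'i; apply/negP => /FD /DD'; exact.
pose e i := if i \in F then eta i else eta' i.
have -> : cylF F' eta' `&` cylF F eta = cylF (F' `|` F)%fset e.
  apply/seteqP; split=> w.
    move=> [h1 h2] i; rewrite in_fsetU /e; case: ifP => iF; first by rewrite h2.
    by rewrite orbF => /h1.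
  move=> h; split=> i iF; rewrite h ?in_fsetU ?iF ?orbT // /e ?iF //.
  by rewrite (negbTE (disj _ iF)).
have hmu' F0 e0 : mu (cylF F0 e0) = (\prod_(i <- F0) (if e0 i then p else 1 - p))%:E.
  exact: hmu.
rewrite !hmu' -EFinM; congr (_%:E).
rewrite (perm_big (F' ++ F)) /=; last first.
  apply: uniq_perm; first exact: fset_uniq.
    rewrite cat_uniq !fset_uniq andbT /=; apply/hasPn => i iF.
    by apply/negP => /disj; rewrite iF.
  by move=> i; rewrite in_fsetU mem_cat.
rewrite big_cat /=; congr (_ * _); apply: eq_big_seq => i iF; rewrite /e ?iF //.
by rewrite (negbTE (disj _ iF)).
Qed.

Lemma bernoulli_coord (R : realType) (p : R) (mu : probability OmegaM R) i b :
  is_bernoulli_product p mu ->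
  mu [set w : config | w i = b] = (if b then p else 1 - p)%:E.
Proof.
move=> hmu; have := hmu [fset i]%fset (fun=> b); rewrite big_seq_fset1 => <-.
congr (mu _); apply/seteqP; split=> w /=; first by move=> <- j /fset1P ->.
by apply; rewrite fset11.
Qed.

(** * Transfer along a window *)

(** Thinning as a rule reading [w] only at [x - 1] and [x]. A vacant site of [v] next to an occupied
    one must be vacant in [w], otherwise it would survive. Runs of free sites admit only isolated
    occupied spins, that is, no two adjacent ones; the pair [x], [x + 1] is left to the rule at
    [x + 1]. *)
Definition compat (v w : config) (x : int) : bool :=
  if free v x then ~~ (w (x - 1) && w x) else w x == v x.

Definition compatw (v : config) (a : int) (k : nat) (w : config) : bool :=
  all (fun j : nat => compat v w (a + j%:Z)) (iota 0 k.+1).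

Lemma compatwS v a k w :
  compatw v a k.+1 w = compatw v a k w && compat v w (a + k.+1%:Z).
Proof. by rewrite /compatw -[k.+2]addn1 iotaD all_cat /= andbT. Qed.

Lemma compatwP v a k w :
  reflect (forall x, a <= x <= a + k%:Z -> compat v w x) (compatw v a k w).
Proof.
apply: (iffP allP) => h.
  move=> x ax; have -> : x = a + (`|x - a|%N)%:Z by lia.
  by apply: h; rewrite mem_iota; lia.
by move=> j; rewrite mem_iota => jk; apply: h; lia.
Qed.

(** The rule reads the preceding site only at free sites, so nothing before a non-free [a] is
    read. *)
Lemma compatw_local v a k w w' : ~~ free v a ->
  (forall x, a <= x <= a + k%:Z -> w x = w' x) -> compatw v a k w = compatw v a k w'.
Proof.
move=> fa ww'; apply/compatwP/compatwP => h x ax; move: (h x ax);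
rewrite /compat; case: ifP => fx; try (by rewrite ww');
have xa : x != a by [apply: contraTneq fx => ->; rewrite (negbTE fa)|
                     apply/negP => /eqP xa; rewrite xa (negbTE fa) in fx];
by rewrite !ww' //; lia.
Qed.

Definition zint (a b : int) : set int := [set x | a <= x <= b].

Lemma compatw_sigma v a k b : ~~ free v a -> a + k%:Z <= b ->
  <<s cyl (zint a b) >> [set w | compatw v a k w].
Proof.
move=> fa kb; apply: sigma_cyl_of_local; last first.
  move=> w w' ww' /=; rewrite (@compatw_local v a k w w') // => x ax.
  by apply: ww'; rewrite /zint /=; lia.
have m x : cmeas (fun w => compat v w x).
  rewrite /compat; case: (free v x).
    exact: (cmeas_comp (fun q : bool * bool => ~~ (q.1 && q.2))
      (cmeas_pair (cmeas_coord (x - 1)) (cmeas_coord x))).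
  exact: (cmeas_comp (fun q : bool => q == v x) (cmeas_coord x)).
apply: (cmeas_preimage (fun b : bool => b)).
apply: (@cmeas_ext _ (fun w => all id [seq compat v w (a + j%:Z) | j <- iota 0 k.+1])).
  by move=> w; rewrite all_map.
exact: (cmeas_comp (all id) (cmeas_map (iota 0 k.+1) (fun j : nat => m (a + j%:Z)))).
Qed.

(** The window weight built from left to right: a component contributes when it closes, at a free
    site followed by a non-free one. *)
Definition wprod (R : realType) (p : R) (v : config) (D : {fset int}) (a : int) (k : nat) : R :=
  \prod_(j <- iota 0 k.+1) site p v (a + j%:Z) *
  \prod_(j <- iota 0 k | ~~ free v (a + j.+1%:Z) && free v (a + j%:Z))
     ZU p D (comp v (a + j%:Z)).

Lemma wprodS (R : realType) (p : R) v D a k :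
  wprod p v D a k.+1 = wprod p v D a k * site p v (a + k.+1%:Z) *
    (if free v (a + k.+1%:Z) then 1 else
     if free v (a + k%:Z) then ZU p D (comp v (a + k%:Z)) else 1).
Proof.
rewrite /wprod -[k.+2]addn1 -{2}[k.+1]addn1 !iotaD !big_cat /= !add0n.
rewrite big_seq1 [X in _ * (_ * X) = _]big_mkcond big_seq1 mulrACA mulrA.
by congr (_ * _); case: (free v (a + k.+1%:Z)).
Qed.

Lemma site_free (R : realType) (p : R) v x : free v x -> site p v x = 1.
Proof.
rewrite /free /site => /andP[/andP[/negbTE -> /negbTE ->] /negbTE ->]; by [].
Qed.

Lemma site_nonfree (R : realType) (p : R) v x : ~~ free v x ->
  site p v x = if v x then p else 1 - p.
Proof.
rewrite /free /site; case: (v x) => //.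
by rewrite andbT negb_and !negbK => ->.
Qed.

(* Inside a run of free sites the pair (total mass, mass with a vacant last
   site) evolves by the transfer matrix [Qm]. *)
Lemma compatw_measure (R : realType) (p : R) (mu : probability OmegaM R)
    (v : config) (D : {fset int}) (a : int) (k : nat) :
  0 < p < 1 -> is_bernoulli_product p mu -> v a ->
  let P := wprod p v D a k in
  let q n := (Qm p ^+ n) 0 0 in
  let Ek := [set w : config | compatw v a k w] in
  let x := a + k%:Z in
  if free v x then
    exists i : nat, [/\ (0 < i <= k)%N, ~~ free v (x - i%:Z),
      forall j : nat, (j < i)%N -> free v (x - j%:Z),
      mu Ek = (P * (q i.+1 / (1 - p)))%:E &
      mu (Ek `&` [set w : config | w x = false]) = (P * q i)%:E]
  else mu Ek = P%:E /\
    (~~ v x -> mu (Ek `&` [set w : config | w x = false]) = P%:E).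
Proof.
move=> hp hmu va; have /andP[p0 p1] := hp.
have q0 : 1 - p != 0 by rewrite subr_eq0 eq_sym lt_eqF.
have fa : ~~ free v a by rewrite /free va andbF.
have ind b k' (S : set config) : <<s cyl (zint a (a + k'%:Z)) >> S ->
    mu (S `&` [set w : config | w (a + k'.+1%:Z) = b]) =
    (mu S * (if b then p else 1 - p)%:E)%E.
  move=> mS; rewrite (bernoulli_indep (D := zint a (a + k'%:Z)) (D' := [set a + k'.+1%:Z])
    hmu _ mS (sigma_cyl_coord _ _)) ?(bernoulli_coord _ _ hmu) //.
  by move=> i; rewrite /zint /= => + iE; rewrite iE; lia.
cbv zeta; elim: k => [|k IH].
  rewrite addr0 (negbTE fa) va; split => //.
  rewrite /wprod big_seq1 big_nil mulr1 addr0 /site va -(bernoulli_coord a true hmu).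
  congr (mu _); apply/seteqP; split=> w /=;
  by rewrite /compatw /= andbT addr0 /compat (negbTE fa) va => /eqP.
have mE : <<s cyl (zint a (a + k%:Z)) >> [set w | compatw v a k w].
  exact: compatw_sigma.
set x := a + k.+1%:Z; have xE : x - 1 = a + k%:Z by rewrite /x; lia.
rewrite wprodS -/x; case fx : (free v x);
  cbv iota; last first.
  have -> : [set w | compatw v a k.+1 w] =
      [set w | compatw v a k w] `&` [set w : config | w x = v x].
    apply/seteqP; split=> w /=; rewrite compatwS -/x /compat fx.
      by move=> /andP[-> /eqP].
    by move=> [-> ->]; rewrite eqxx.
  have E : mu ([set w | compatw v a k w] `&` [set w : config | w x = v x]) =
      (wprod p v D a k * site p v x *
       (if free v (a + k%:Z) then ZU p D (comp v (a + k%:Z)) else 1))%:E.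
    rewrite ind // site_nonfree ?fx //.
    move: IH; have [fy|fy] := boolP (free v (a + k%:Z)); rewrite ?fy ?(negbTE fy); cbv iota.
      case=> i [i0 nf fr -> _].
      (* The run of [i] free sites ends here and is a whole component; the mass [q i.+1 / (1 - p)]
         accumulated along it is its [ZU]. *)
      have -> : comp v (a + k%:Z) = (Some (a + k%:Z - i%:Z + 1), Some (a + k%:Z)).
        apply: comp_eq; last by rewrite /inc /=; lia.
        split.
        - move=> y; rewrite /inc /= => yb.
          have -> : y = a + k%:Z - (absz (a + k%:Z - y)%R)%:Z by lia.
          by apply: fr; lia.
        - by move=> _ [<-]; have -> : a + k%:Z - i%:Z + 1 - 1 = a + k%:Z - i%:Z by lia.
        - move=> _ [<-]; have -> : a + k%:Z + 1 = x by rewrite /x; lia.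
          by rewrite fx.
      rewrite -EFinM /=; congr (_%:E).
      have -> : absz (a + k%:Z - (a + k%:Z - i%:Z + 1) + 2)%R = i.+1 by lia.
      by move: (if v x then p else 1 - p) => s; ring.
    by case=> -> _; rewrite -EFinM mulr1.
  split=> // vx; rewrite -E; congr (mu _); apply/seteqP; split=> w /=; first by case.
  by move=> [h1 h2]; split=> //; rewrite h2 (negbTE vx).
rewrite site_free // !mulr1.
(* A vacant new site does not constrain its predecessor, an occupied one requires it to be vacant.
   The new total mass is [1 - p] times the old total plus [p] times the old vacant mass, which is
   [Qm00_rec] up to normalization. *)
set E1 := [set w | compatw v a k.+1 w].
have E10 : E1 `&` [set w : config | w x = false] =
    [set w | compatw v a k w] `&` [set w : config | w x = false].
  apply/seteqP; split=> w /= [+ wx]; rewrite /E1 /= compatwS -/x /compat fx wx andbF.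
    by move=> /andP[].
  by move=> ->.
have E11 : E1 `&` [set w : config | w x = true] =
    ([set w | compatw v a k w] `&` [set w : config | w (a + k%:Z) = false])
    `&` [set w : config | w x = true].
  apply/seteqP; split=> w /=.
    move=> [+ wx]; rewrite /E1 /= compatwS -/x /compat fx xE wx andbT => /andP[-> ].
    by move/negbTE.
  by move=> [[h1 h2] wx]; split=> //; rewrite /E1 /= compatwS -/x /compat fx xE h1 h2.
have mE0 : <<s cyl (zint a (a + k%:Z)) >>
    ([set w | compatw v a k w] `&` [set w : config | w (a + k%:Z) = false]).
  apply: (@measurableI _ (g_sigma_algebraType (cyl (zint a (a + k%:Z))))) => //.
  by apply: sigma_cyl_coord; rewrite /zint /=; lia.
have mE1 : measurable (E1 : set OmegaM).
  by apply: (@sigma_cyl_measurable (zint a x)); apply: compatw_sigma.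
have E1E : mu E1 = (mu (E1 `&` [set w : config | w x = false])
    + mu (E1 `&` [set w : config | w x = true]))%E.
  rewrite -measureU; last 3 first.
  - by apply: measurableI => //; exact: sigma_cyl_coord.
  - by apply: measurableI => //; exact: sigma_cyl_coord.
  - by apply/seteqP; split=> w //= [[_ ->] []].
  congr (mu _); apply/seteqP; split=> w /=; last by case=> -[].
  by case E : (w x); [right|left].
rewrite E1E E10 E11 !ind //.
move: IH; have [fy|fy] := boolP (free v (a + k%:Z)); rewrite ?fy ?(negbTE fy); cbv iota.
  case=> i [i0 nf fr -> ->]; exists i.+1; split.
  - lia.
  - by have -> : x - i.+1%:Z = a + k%:Z - i%:Z by rewrite /x; lia.
  - case=> [|j] ji; first by rewrite subr0.
    by have -> : x - j.+1%:Z = a + k%:Z - j%:Z by [rewrite /x; lia]; apply: fr.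
  - rewrite -!EFinM -EFinD; congr (_%:E); rewrite [in RHS]Qm00_rec //.
    by field.
  - by rewrite -EFinM; congr (_%:E); field.
(* First free site of a run, [i = 1]: after the forced vacancy both spins are allowed, and
   [q 2 = 1 - p], so the total mass is unchanged. *)
have vy : ~~ v (a + k%:Z).
  by move: fx; rewrite /free xE => /andP[/andP[]].
case=> -> /(_ vy) ->; exists 1%N; split => //.
- by rewrite xE.
- by case=> // _; rewrite subr0.
- rewrite -!EFinM -EFinD; congr (_%:E); rewrite Qm00_rec // Qm00_1 Qm00_0.
  by field.
- by rewrite -EFinM Qm00_1.
Qed.

Definition window (a : int) (n : nat) : {fset int} :=
  [fset x in [seq (a + j.+1%:Z)%R | j <- iota 0 n.-1]]%fset.

Lemma mem_window a n x : (x \in window a n) = (a < x < a + n%:Z).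
Proof.
rewrite /window in_fset /=; apply/mapP/idP => [[j]|ax].
  by rewrite mem_iota => jn ->; lia.
by exists (absz (x - a)%R).-1; [rewrite mem_iota; lia|lia].
Qed.

Lemma mem_barS_window a n x : (1 < n)%N ->
  (x \in barS (window a n)) = (a <= x <= a + n%:Z).
Proof. by move=> n1; rewrite mem_barS !mem_window; lia. Qed.

(** The occupied ends keep each component touching the window strictly inside it, and its right
    endpoint indexes it once, so the products of [weight] and [wprod] agree up to order. *)
Lemma weight_window (R : realType) (p : R) (v : config) a n : (3 < n)%N ->
  v a -> v (a + 1) -> v (a + n%:Z - 1) -> v (a + n%:Z) ->
  weight p (window a n) v = wprod p v (window a n) a n.
Proof.
move=> n3 va va1 vb1 vb; have n1 : (1 < n)%N by lia.
rewrite weightE /wprod; congr (_ * _).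
  rewrite -(big_map (fun j : nat => a + j%:Z) xpredT (site p v)); apply: perm_big.
  apply: uniq_perm; first exact: undup_uniq.
    by rewrite map_inj_uniq ?iota_uniq // => i j; lia.
  move=> x; rewrite mem_barS_window //; apply/idP/mapP => [ax|[j]].
    by exists (absz (x - a)%R); [rewrite mem_iota; lia|lia].
  by rewrite mem_iota => jn ->; lia.
rewrite -[RHS]big_filter.
rewrite -(big_map (fun j : nat => comp v (a + j%:Z)) xpredT (ZU p _)); apply: perm_big.
have compj (j : nat) : free v (a + j%:Z) -> ~~ free v (a + j.+1%:Z) ->
    (comp v (a + j%:Z)).2 = Some (a + j%:Z).
  move=> fj nf; have [[f1 _ r1]] := comp_spec fj; rewrite /inc.
  case: (comp v _) f1 r1 => l [b|] f1 r1 /= /andP[lj rj].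
    congr Some; apply/eqP; rewrite eq_le rj andbT leNgt; apply/negP => jb.
    case/negP: nf; apply: f1; rewrite /inc /=; case: (l) lj => [l'|] lj /=; lia.
  by case/negP: nf; apply: f1; rewrite /inc /=; case: (l) lj => [l'|] lj /=; lia.
apply: uniq_perm; first exact: undup_uniq.
  rewrite map_inj_in_uniq ?filter_uniq ?iota_uniq // => i j.
  rewrite !mem_filter => /andP[/andP[nfi fi] _] /andP[/andP[nfj fj] _].
  by move/(congr1 snd); rewrite !compj // => -[]; lia.
have nf x : v x || v (x - 1) || v (x + 1) -> ~~ free v x.
  by rewrite /free; case: (v x); case: (v (x - 1)); case: (v (x + 1)).
(* [comps] looks one site beyond the closed window, so the outer neighbours must be non-free too. *)
have nfa1 : ~~ free v (a - 1) by apply: nf; rewrite subrK va !orbT.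
have nfa : ~~ free v a by apply: nf; rewrite va.
have nfb : ~~ free v (a + n%:Z) by apply: nf; rewrite vb.
have nfb1 : ~~ free v (a + n%:Z + 1) by apply: nf; rewrite addrK vb !orbT.
move=> c; apply/idP/mapP.
  move/mem_comps => [[f1 l1 r1] [x]]; rewrite mem_barS !mem_barS_window // => ax cx.
  have fx := f1 x cx.
  have [xa xb] : a < x /\ x < a + n%:Z.
    split; rewrite ltNge; apply/negP => h.
      have : (x == a - 1) || (x == a) by lia.
      by case/orP => /eqP xE; move: fx; rewrite xE ?(negbTE nfa) ?(negbTE nfa1).
    have : (x == a + n%:Z) || (x == a + n%:Z + 1) by lia.
    by case/orP => /eqP xE; move: fx; rewrite xE ?(negbTE nfb) ?(negbTE nfb1).
  case: c f1 l1 r1 cx => l [r|] f1 l1 r1; rewrite /inc /= => /andP[lx xr]; last first.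
    case/negP: nfb; apply: f1; rewrite /inc /=; case: (l) lx => [l'|] lx /=; lia.
  have rb : r < a + n%:Z.
    rewrite ltNge; apply/negP => h; case/negP: nfb; apply: f1; rewrite /inc /=.
    by case: (l) lx => [l'|] lx /=; lia.
  have rE : a + (absz (r - a)%R)%:Z = r by clear -xa xr; lia.
  have fr : inc (l, Some r) r by rewrite /inc /= lexx andbT; case: (l) lx => [l'|] lx /=; lia.
  exists (absz (r - a)%R).
    rewrite mem_filter mem_iota; apply/andP; split; last by clear -xa xr rb; lia.
    have -> : a + (absz (r - a)%R).+1%:Z = r + 1 by clear -xa xr; lia.
    by rewrite rE (r1 _ erefl); exact: f1.
  by apply/esym; rewrite rE; apply: comp_eq.
case=> j; rewrite mem_filter mem_iota => /andP[/andP[nfj fj] jn] ->.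
have [h1 h2] := comp_spec fj; apply/mem_comps; split => //.
by exists (a + j%:Z) => //; rewrite mem_barS !mem_barS_window //; clear -jn; lia.
Qed.

(** The pairs certify that the end sites survive without a look outside the window; at a free site,
    the rules at [x] and [x + 1] together exclude occupied neighbours on both sides. *)
Lemma Tmap_window (v w : config) a (n : nat) : (3 < n)%N -> Omega' v ->
  v a -> v (a + 1) -> v (a + n%:Z - 1) -> v (a + n%:Z) ->
  (forall x, a <= x <= a + n%:Z -> Tmap w x = v x) <-> compatw v a n w.
Proof.
move=> n3 /Omega'P Ov va va1 vb1 vb; split.
  move=> Tw; apply/compatwP => x ax; rewrite /compat; case: ifP => fx.
    have vx : ~~ v x by move: fx; rewrite /free => /andP[/andP[]].
    by move: (Tw x ax) vx => <-; rewrite /Tmap; case: (w x); case: (w (x - 1)).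
  have [vx|vx] := boolP (v x).
    by move: (Tw x ax); rewrite vx /Tmap => /andP[->].
  have xE : (x != a) && (x != a + 1) && (x != a + n%:Z - 1) && (x != a + n%:Z).
    by rewrite -!negb_or; apply: contra vx => /orP[/orP[/orP[]|]|] /eqP ->.
  apply/eqP/negbTE/negP => wx.
  have : v (x - 1) || v (x + 1).
    by move: fx; rewrite /free (negbTE vx); case: (v (x - 1)) => //=; case: (v (x + 1)).
  case/orP => vy.
    have : Tmap w (x - 1) by rewrite Tw //; lia.
    rewrite /Tmap => /andP[wy _]; case/negP: vx.
    by rewrite -(Tw x ax) /Tmap wx wy.
  have : Tmap w (x + 1) by rewrite Tw //; lia.
  rewrite /Tmap => /andP[wy _]; case/negP: vx.
  by rewrite -(Tw x ax) /Tmap wx wy orbT.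
move/compatwP => cw.
have occ x : a <= x <= a + n%:Z -> v x -> w x.
  move=> ax vx; move: (cw x ax); rewrite /compat /free vx andbF /=.
  by move/eqP.
move=> x ax; have [vx|vx] := boolP (v x).
  rewrite /Tmap occ //=.
  have [->|xa] := eqVneq x a; first by rewrite (occ (a + 1)) ?orbT //; lia.
  have [->|xb] := eqVneq x (a + n%:Z); first by rewrite (occ (a + n%:Z - 1)) //; lia.
  by case/orP: (Ov x vx) => vy; rewrite (occ _ _ vy) ?orbT //; lia.
apply/negbTE; rewrite /Tmap.
have := cw x ax; rewrite /compat; case: ifP => fx; last by rewrite (negbTE vx) => /eqP ->.
have vx1 : ~~ v (x + 1) by move: fx; rewrite /free => /andP[_].
have xb : x != a + n%:Z by apply: contraTneq vb => <-.
have := cw (x + 1); rewrite /compat addrK (negbTE vx1).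
have -> : a <= x + 1 <= a + n%:Z by lia.
move=> /(_ isT); case: ifP => _.
  by case: (w x); case: (w (x - 1)); case: (w (x + 1)).
by move/eqP ->; case: (w x); case: (w (x - 1)).
Qed.

Lemma window_measure (R : realType) (p : R) (mu : probability OmegaM R)
    (v : config) a (n : nat) : 0 < p < 1 -> is_bernoulli_product p mu ->
  (3 < n)%N -> Omega' v -> v a -> v (a + 1) -> v (a + n%:Z - 1) -> v (a + n%:Z) ->
  mu [set w | forall x, a <= x <= a + n%:Z -> Tmap w x = v x] =
  (weight p (window a n) v)%:E.
Proof.
move=> hp hmu n3 Ov va va1 vb1 vb.
have -> : [set w | forall x, a <= x <= a + n%:Z -> Tmap w x = v x] =
    [set w | compatw v a n w].
  by apply/seteqP; split=> w /=; move/Tmap_window; apply.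
rewrite weight_window //.
have := compatw_measure (window a n) n hp hmu va; cbv zeta.
have /negbTE -> : ~~ free v (a + n%:Z) by rewrite /free vb andbF.
by case.
Qed.

(** * The Gibbs property *)

Lemma cmeas_Tmap i : cmeas (fun w => Tmap w i).
Proof.
exact: (cmeas_comp (fun q : bool * bool * bool => q.2 && (q.1.1 || q.1.2))
  (cmeas_pair (cmeas_pair (cmeas_coord (i - 1)) (cmeas_coord (i + 1))) (cmeas_coord i))).
Qed.

Lemma Tmap_preimage (A : set config) : measurable (A : set OmegaM) ->
  measurable (Tmap @^-1` A : set OmegaM).
Proof.
apply: (@sigma_cyl_preimage setT setT) => i _.
exact: (cmeas_preimage (fun b : bool => b) (cmeas_Tmap i)).
Qed.

Lemma cmeas_comp_Tmap U (h : config -> U) : cmeas h -> cmeas (fun w => h (Tmap w)).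
Proof.
case=> T [f [g [mf hE]]]; exists T, (fun w => f (Tmap w)), g; split=> // y.
exact: (Tmap_preimage (mf y)).
Qed.

Lemma Omega'_Tmap w : Omega' (Tmap w).
Proof. by exists w. Qed.

Lemma cmeas_mass (R : realType) (p : R) (L : {fset int}) (xi : {ffun L -> bool}) :
  cmeas (fun w => mass p w xi).
Proof.
have mW (eta : {ffun L -> bool}) := cmeas_glue eta (cmeas_weight p L).
have mO (eta : {ffun L -> bool}) := cmeas_glue_asbool eta measurable_Omega'.
have mZ : cmeas (ZL p L) := cmeas_sum (index_enum _) mO mW.
exact: (cmeas_comp (fun q : bool * R * R => if q.1.1 then q.1.2 / q.2 else 0)
  (cmeas_pair (cmeas_pair (mO xi) (mW xi)) mZ)).
Qed.

Lemma cmeas_restr (L : {fset int}) : cmeas (restr L).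
Proof.
have m := cmeas_map (enum {: L}) (fun j : L => cmeas_coord (fsval j)).
apply: (@cmeas_ext _ (fun w => [ffun j : L => nth false [seq w (fsval j) | j <- enum {: L}]
    (index j (enum {: L}))])).
  move=> w; apply/ffunP => j; rewrite !ffunE (nth_map j) ?index_mem ?mem_enum //.
  by rewrite nth_index ?mem_enum.
exact: (cmeas_comp (fun s => [ffun j : L => nth false s (index j (enum {: L}))]) m).
Qed.

Lemma measure_partition (R : realType) (mu : {measure set OmegaM -> \bar R}) (I : finType)
    (g : config -> I) (X : set config) : cmeas g -> measurable (X : set OmegaM) ->
  mu X = (\sum_i mu (X `&` [set w | g w = i]))%E.
Proof.
move=> mg mX; have mgi (Y : set I) : measurable ([set w | Y (g w)] : set OmegaM).
  exact: cmeas_preimage.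
have H : forall s : seq I, uniq s ->
    mu (X `&` [set w | g w \in s]) = (\sum_(i <- s) mu (X `&` [set w | g w = i]))%E.
  elim=> [_|i s IH /= /andP[is_ us]].
    by rewrite big_nil (_ : _ `&` _ = set0) ?measure0 //; apply/seteqP; split=> w // -[].
  rewrite big_cons -IH // -measureU.
  - rewrite -setIUr; congr (mu (_ `&` _)); apply/seteqP; split=> w /=; rewrite inE.
      by case/orP => [/eqP|]; [left|right].
    by case=> [->|->]; rewrite ?eqxx ?orbT.
  - by apply: measurableI => //; exact: (mgi [set i]).
  - by apply: measurableI => //; exact: (mgi [set j | j \in s]).
  - by apply/seteqP; split=> w //= -[[_ gi] [_]]; rewrite gi (negbTE is_).
rewrite -H ?index_enum_uniq //; congr (mu _); apply/seteqP; split=> w; last by case.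
by move=> Xw; split => //=; rewrite mem_index_enum.
Qed.

(** The occupied sites [a] and [b] enclose every component touching [L], so all that the weight
    reads lies between them. *)
Lemma weight_local (R : realType) (p : R) (L : {fset int}) (u u' : config) (a b : int) :
  a <= b -> (forall x, x \in L -> a + 1 < x < b - 1) -> (forall x, a <= x <= b -> u x = u' x) ->
  u a -> u b -> weight p L u = weight p L u'.
Proof.
move=> ab Lab uu' ua ub; rewrite !weightE.
have bL x : x \in barS L -> a < x < b by rewrite mem_barS => /or3P[] /Lab; lia.
have bbL x : x \in barS (barS L) -> a <= x <= b.
  by rewrite mem_barS => /or3P[] /bL; lia.
congr (_ * _).
  by apply: eq_big_seq => x /bL xb; rewrite /site !uu' //; lia.
apply: perm_big; apply: uniq_perm; try exact: undup_uniq.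
have H (v v' : config) c : (forall x, a <= x <= b -> v x = v' x) -> v a -> v b ->
    c \in comps v L -> c \in comps v' L.
  move=> vv' va vb /mem_comps[[f1 l1 r1] [x xL cx]].
  have nfa : ~~ free v a by rewrite /free va andbF.
  have nfb : ~~ free v b by rewrite /free vb andbF.
  have xab := bbL _ xL.
  have E y : a < y < b -> free v y = free v' y by move=> yb; rewrite /free !vv' //; lia.
  have va' : v' a by rewrite -vv' //; lia.
  have vb' : v' b by rewrite -vv' //; lia.
  case: c f1 l1 r1 cx => [l r] f1 l1 r1; rewrite /inc /= => cx.
  have [l0 lE] : exists l0, l = Some l0.
    case: (l) f1 cx => [l0|] f1 cx; first by exists l0.
    by case/negP: nfa; apply: f1; rewrite /inc /=; case: (r) cx => [r0|]; lia.
  have [r0 rE] : exists r0, r = Some r0.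
    case: (r) f1 cx => [r0|] f1 cx; first by exists r0.
    by case/negP: nfb; apply: f1; rewrite /inc lE /=; rewrite lE in cx; lia.
  subst l r.
  have al : a < l0.
    by rewrite ltNge; apply/negP => h; case/negP: nfa; apply: f1; rewrite /inc /=; lia.
  have rb : r0 < b.
    by rewrite ltNge; apply/negP => h; case/negP: nfb; apply: f1; rewrite /inc /=; lia.
  apply/mem_comps; split; last by exists x.
  split=> /=.
  - by move=> y; rewrite /inc /= => cy; rewrite -E; [apply: f1|lia].
  - move=> _ [<-]; have [->|h] := eqVneq (l0 - 1) a; first by rewrite /free va' andbF.
    by rewrite -E; [apply: l1|lia].
  - move=> _ [<-]; have [->|h] := eqVneq (r0 + 1) b; first by rewrite /free vb' andbF.
    by rewrite -E; [apply: r1|lia].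
move=> c; apply/idP/idP; apply: H => //.
- by move=> x xab; rewrite uu'.
- by rewrite -uu' //; lia.
- by rewrite -uu' //; lia.
Qed.

Lemma glue_window (L : {fset int}) (xi : {ffun L -> bool}) (v v0 : config) (a b : int) :
  (forall x, a <= x <= b -> x \notin L -> v x = v0 x) ->
  forall x, a <= x <= b -> glue xi v x = glue xi v0 x.
Proof.
move=> vv0 x ax; have [xL|xL] := boolP (x \in L); last by rewrite !glue_out // vv0.
by rewrite -[x]/(fsval [` xL]%fset) !glue_in.
Qed.

Lemma Omega'_glue_window (L : {fset int}) (xi : {ffun L -> bool}) (v v0 : config) (a b : int) :
  (forall x, x \in L -> a + 1 < x < b - 1) ->
  (forall x, a <= x <= b -> x \notin L -> v x = v0 x) ->
  Omega' v0 -> Omega' (glue xi v) -> Omega' (glue xi v0).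
Proof.
move=> Lab vv0 /Omega'P O0 /Omega'P O; apply/Omega'P => x.
have E := glue_window xi vv0.
have out y : ~~ (a + 1 < y < b - 1) -> glue xi v0 y = v0 y.
  by move=> yab; rewrite glue_out //; apply: contra yab => /Lab.
have [xab|xab] := boolP (a < x < b).
  by rewrite -!E; [exact: O|lia|lia|lia].
by rewrite !out; [exact: O0|lia|lia|lia].
Qed.

(* The occupied pairs at both ends of the window decouple the configuration
   inside the window from the one outside. *)
Lemma window_factor (R : realType) (p : R) (mu : probability OmegaM R) (L : {fset int})
    (a : int) (n : nat) (v0 : config) (A : set config) :
  0 < p < 1 -> is_bernoulli_product p mu -> (3 < n)%N ->
  (forall x, x \in L -> a + 1 < x < a + n%:Z - 1) ->
  Omega' v0 -> v0 a -> v0 (a + 1) -> v0 (a + n%:Z - 1) -> v0 (a + n%:Z) ->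
  <<s cyl (Lc L) >> A ->
  (forall v, A v -> forall x, a <= x <= a + n%:Z -> x \notin L -> v x = v0 x) ->
  exists M : \bar R, forall xi : {ffun L -> bool},
    mu (Tmap @^-1` A `&` [set w | restr L (Tmap w) = xi]) =
    ((if `[< Omega' (glue xi v0) >] then weight p (window a n) (glue xi v0) else 0)%:E * M)%E.
Proof.
move=> hp hmu n3 Lab O0 va va1 vb1 vb mA AC.
pose b := a + n%:Z.
(* Outside the window, thinning reads at most the two end sites of the window, which are occupied on
   the event [E] below. Filling the window thus changes nothing there: on [E], [Psi] reproduces the
   thinned configuration off [L] while reading only spins outside the window. *)
pose Phi (w : config) : config := fun i => (a <= i <= b) || w i.
pose Psi (w : config) : config := fun i => if a <= i <= b then v0 i else Tmap (Phi w) i.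
have mPhi i : cmeas (fun w => Phi w i).
  exact: (cmeas_comp (fun q : bool => (a <= i <= b) || q) (cmeas_coord i)).
have mPsi : <<s cyl (~` zint a b) >> (Psi @^-1` A).
  apply: (sigma_cyl_preimage _ mA) => i _; apply: sigma_cyl_of_local.
    apply: (cmeas_preimage (fun b : bool => b)); rewrite /Psi.
    case: (a <= i <= b); first exact: cmeas_cst.
    exact: (cmeas_comp (fun q : bool * bool * bool => q.2 && (q.1.1 || q.1.2))
      (cmeas_pair (cmeas_pair (mPhi (i - 1)) (mPhi (i + 1))) (mPhi i))).
  move=> w w' ww'; have E : Phi w = Phi w'.
    apply/funext => j; rewrite /Phi; case: (boolP (a <= j <= b)) => //= jab.
    by apply: ww'; rewrite /zint /=; apply/negP.
  by rewrite /= /Psi E.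
have outL x : ~~ (a + 1 < x < b - 1) -> x \notin L by apply: contra => /Lab.
exists (mu (Psi @^-1` A)) => xi; set th := glue xi v0.
have tha : th a by rewrite /th glue_out //; apply: outL; clear; lia.
have tha1 : th (a + 1) by rewrite /th glue_out //; apply: outL; clear; lia.
have thb1 : th (a + n%:Z - 1) by rewrite /th glue_out //; apply: outL; rewrite /b; clear; lia.
have thb : th (a + n%:Z) by rewrite /th glue_out //; apply: outL; rewrite /b; clear; lia.
pose E := [set w | forall x, a <= x <= a + n%:Z -> Tmap w x = th x].
have occ w x : Tmap w x -> w x by rewrite /Tmap => /andP[].
have -> : Tmap @^-1` A `&` [set w | restr L (Tmap w) = xi] = E `&` (Psi @^-1` A).
  have key w : E w -> agree_off L (Tmap w) (Psi w).
    move=> Ew x xL; rewrite /Psi; case: ifP => xab.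
      by rewrite Ew // /th glue_out.
    have wa : w a by apply: occ; rewrite Ew //; clear; lia.
    have wb : w b by apply: occ; rewrite Ew // /b; clear; lia.
    have PhiE y : ~~ (a < y < b) -> w y = Phi w y.
      move=> yab; rewrite /Phi; case: (boolP (a <= y <= b)) => //= yab'.
      have : (y == a) || (y == b) by clear -yab yab'; lia.
      by case/orP => /eqP ->; rewrite ?wa ?wb.
    by rewrite /Tmap !PhiE //; clear -xab; lia.
  apply/seteqP; split=> w /= [].
    move=> Aw rw; have Ew : E w.
      move=> x xab; rewrite /th -(glue_window xi (AC _ Aw) xab).
      by rewrite -rw glue_restr.
    split => //; apply: (sigma_cyl_local mA _ Aw) => i; exact: key.
  move=> Ew Aw; split.
    by apply: (sigma_cyl_local mA _ Aw) => i iL; rewrite key.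
  apply/ffunP => j; rewrite ffunE Ew; first by rewrite /th glue_in.
  by move: (Lab _ (fsvalP j)); clear; lia.
case: asboolP => Oth.
  have Em : <<s cyl (zint a b) >> E.
    have -> : E = [set w | compatw th a n w].
      by apply/seteqP; split=> w /=; move/Tmap_window; apply.
    by apply: compatw_sigma; rewrite // /free tha andbF.
  rewrite (bernoulli_indep hmu _ Em mPsi); first by rewrite (window_measure hp).
  by move=> i h; apply.
(* An inadmissible pattern is never reached: inside the window [th] would be a thinned
   configuration, and near or beyond the ends it coincides with [v0]. *)
rewrite (_ : E = set0) ?set0I ?measure0 ?mul0e //.
apply/seteqP; split=> w // Ew; apply: Oth.
apply/Omega'P => x thx; have /Omega'P OT := Omega'_Tmap w; move/Omega'P: O0 => O0.
have [xab|xab] := boolP (a < x < b).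
  have {}xab : a < x < a + n%:Z := xab.
  by rewrite -!Ew; [apply: OT; rewrite Ew //; clear -xab|clear -xab|clear -xab]; lia.
have out y : ~~ (a + 1 < y < b - 1) -> th y = v0 y by move=> /outL yL; rewrite /th glue_out.
by move: thx; rewrite !out; [exact: O0|clear -xab..]; lia.
Qed.

(** By [window_factor] the conditional probabilities in [L] are proportional to window weights, and
    [weight_cross] replaces these by weights of [L]. The kernel is constant on [A], since all that
    it reads is prescribed there. *)
Lemma gibbs_window (R : realType) (p : R) (mu : probability OmegaM R) (L : {fset int})
    (a : int) (n : nat) (z : config) (A : set config) (xi : {ffun L -> bool}) :
  0 < p < 1 -> is_bernoulli_product p mu -> (3 < n)%N ->
  (forall x, x \in L -> a + 1 < x < a + n%:Z - 1) ->
  z a -> z (a + 1) -> z (a + n%:Z - 1) -> z (a + n%:Z) ->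
  <<s cyl (Lc L) >> A ->
  (forall v, A v -> forall x, a <= x <= a + n%:Z -> x \notin L -> v x = z x) ->
  mu (Tmap @^-1` A `&` [set w | restr L (Tmap w) = xi]) =
  (\int[mu]_(w in Tmap @^-1` A) (mass p (Tmap w) xi)%:E)%E.
Proof.
move=> hp hmu n3 Lab za za1 zb1 zb mA AC.
(* [z] need not lie in [Omega'], so an admissible reference is taken from [A]; if there is none,
   both sides vanish. *)
have [[v0 [Av0 O0]]|nA] := pselect (exists v, A v /\ Omega' v); last first.
  have -> : Tmap @^-1` A = set0.
    by apply/seteqP; split=> w //= Aw; apply: nA; exists (Tmap w); split => //; exact: Omega'_Tmap.
  by rewrite set0I measure0 integral_set0.
have outL x : ~~ (a + 1 < x < a + n%:Z - 1) -> x \notin L by apply: contra => /Lab.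
have v0z x : ~~ (a + 1 < x < a + n%:Z - 1) -> a <= x <= a + n%:Z -> v0 x = z x.
  by move=> /outL xL xab; apply: AC.
have {za}va : v0 a by rewrite v0z //; clear -n3; lia.
have {za1}va1 : v0 (a + 1) by rewrite v0z //; clear -n3; lia.
have {zb1}vb1 : v0 (a + n%:Z - 1) by rewrite v0z //; clear -n3; lia.
have {zb}vb : v0 (a + n%:Z) by rewrite v0z //; clear -n3; lia.
have {v0z}AC v : A v -> forall x, a <= x <= a + n%:Z -> x \notin L -> v x = v0 x.
  by move=> Av x xab xL; rewrite (AC v) // (AC v0).
have [M MP] := window_factor hp hmu n3 Lab O0 va va1 vb1 vb mA AC.
have mTA := Tmap_preimage (sigma_cyl_measurable mA).
have LD : (L `<=` window a n)%fset.
  by apply/fsubsetP => x /Lab; rewrite mem_window; lia.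
have massE w : A (Tmap w) -> mass p (Tmap w) xi = mass p v0 xi.
  move=> Aw; have OT := Omega'_Tmap w.
  have gE (eta : {ffun L -> bool}) x :
      a <= x <= a + n%:Z -> glue eta (Tmap w) x = glue eta v0 x.
    by apply: glue_window => y; exact: AC.
  have oE (eta : {ffun L -> bool}) :
      `[< Omega' (glue eta (Tmap w)) >] = `[< Omega' (glue eta v0) >].
    apply/asboolP/asboolP; apply: Omega'_glue_window Lab _ _ => //; first exact: AC.
    by move=> x xab xL; rewrite (AC _ Aw).
  have wE (eta : {ffun L -> bool}) :
      weight p L (glue eta (Tmap w)) = weight p L (glue eta v0).
    apply: (@weight_local _ _ _ _ _ a (a + n%:Z)) => //; first by clear -n3; lia.
      exact: gE.
      by rewrite gE ?glue_out //; [apply: outL|]; clear -n3; lia.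
    by rewrite gE ?glue_out //; [apply: outL|]; clear -n3; lia.
  rewrite /mass oE wE; case: ifP => // _; congr (_ / _).
  by rewrite /ZL; apply: eq_big => [eta|eta _].
transitivity ((mass p v0 xi)%:E * mu (Tmap @^-1` A))%E; last first.
  rewrite -integral_cst //; apply: eq_integral => w; rewrite inE => /= Aw.
  by rewrite massE.
rewrite (measure_partition mu (cmeas_comp_Tmap (cmeas_restr L)) mTA).
rewrite (eq_bigr _ (fun eta _ => MP eta)).
rewrite MP.
pose W (eta : {ffun L -> bool}) : R :=
  if `[< Omega' (glue eta v0) >] then weight p (window a n) (glue eta v0) else 0.
have W0 eta : 0 <= W eta by rewrite /W; case: ifP => // _; apply/ltW/weight_gt0.
rewrite -ge0_sume_distrl; last by move=> eta _; rewrite lee_fin W0.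
rewrite muleA sumEFin -EFinM; congr (_%:E * _)%E.
have Z0 : ZL p L v0 != 0 by rewrite gt_eqF // ZL_gt0.
rewrite -/(W xi) /mass; case: asboolP => Oxi; last by rewrite /W asboolF // mul0r.
apply/(mulIf Z0); rewrite [in RHS]mulrAC divfK // /W -big_mkcond /= asboolT // /ZL.
rewrite !mulr_sumr; apply: eq_bigr => eta _.
have ag : agree_off L (glue xi v0) (glue eta v0).
  by move=> x xL; rewrite !glue_out.
by rewrite (weight_cross p LD ag) mulrC.
Qed.

(** * Almost sure occurrence of occupied pairs *)

Definition pair_at (w : config) (y : int) : bool := w y && w (y + 1).

Lemma cmeas_pair_at y : cmeas (fun w => pair_at w y).
Proof.
exact: (cmeas_comp (fun q : bool * bool => q.1 && q.2)
  (cmeas_pair (cmeas_coord y) (cmeas_coord (y + 1)))).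
Qed.

Lemma pair_at_measure (R : realType) (p : R) (mu : probability OmegaM R) y :
  is_bernoulli_product p mu -> mu [set w | ~~ pair_at w y] = (1 - p ^+ 2)%:E.
Proof.
move=> hmu; have -> : [set w | ~~ pair_at w y] =
    ~` ([set w : config | w y = true] `&` [set w : config | w (y + 1) = true]).
  apply/seteqP; split=> w /=; rewrite /pair_at.
    by move=> /negP h [h1 h2]; apply: h; rewrite h1 h2.
  by move=> h; apply/negP => /andP.
rewrite probability_setC; last by apply: measurableI; exact: sigma_cyl_coord.
rewrite (bernoulli_indep (D := [set y]) (D' := [set y + 1]) hmu).
- by rewrite !(bernoulli_coord _ _ hmu) -EFinM -EFinB expr2.
- by move=> i /= iy iy1; clear -iy iy1; lia.
- exact: sigma_cyl_coord.
- exact: sigma_cyl_coord.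
Qed.

(** The spacing makes the pairs disjoint, hence independent, and each is occupied with probability
    [p ^+ 2]. *)
Lemma no_pair_measure (R : realType) (p : R) (mu : probability OmegaM R) (x : nat -> int) N :
  is_bernoulli_product p mu ->
  (forall i j : nat, (i < j)%N -> x i + 1 < x j \/ x j + 1 < x i) ->
  mu [set w | all (fun i => ~~ pair_at w (x i)) (iota 0 N)] = ((1 - p ^+ 2) ^+ N)%:E.
Proof.
move=> hmu xi; elim: N => [|N IH].
  rewrite expr0 -[RHS](@probability_setT _ _ _ mu); congr (mu _).
  by apply/seteqP; split.
have -> : [set w | all (fun i => ~~ pair_at w (x i)) (iota 0 N.+1)] =
    [set w | all (fun i => ~~ pair_at w (x i)) (iota 0 N)] `&` [set w | ~~ pair_at w (x N)].
  have E w : all (fun i => ~~ pair_at w (x i)) (iota 0 N.+1) =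
      all (fun i => ~~ pair_at w (x i)) (iota 0 N) && ~~ pair_at w (x N).
    by rewrite -addn1 iotaD all_cat /= andbT.
  apply/seteqP; split=> w; rewrite [X in X -> _]/mkset [X in _ -> X]/mkset E.
    by case/andP.
  by case=> /= -> ->.
pose D := [set y : int | exists2 i, (i < N)%N & (y = x i \/ y = x i + 1)].
pose D' := [set y : int | y = x N \/ y = x N + 1].
rewrite (bernoulli_indep (D := D) (D' := D') hmu).
- by rewrite IH (pair_at_measure _ hmu) -EFinM -exprSr.
- move=> y [i /xi h1 h2] h3; clear -h1 h2 h3.
  by case: h1 => h1; case: h2 => h2; case: h3 => h3; lia.
- apply: sigma_cyl_of_local.
    apply: (cmeas_preimage (fun b : bool => b)).
    apply: (@cmeas_ext _ (fun w => all negb [seq pair_at w (x i) | i <- iota 0 N])).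
      by move=> w; rewrite all_map.
    exact: (cmeas_comp (all negb) (cmeas_map _ (fun i => cmeas_pair_at (x i)))).
  move=> v w vw /allP h; apply/allP => i; rewrite mem_iota => /andP[_ iN].
  have {}iN : (i < N)%N by move: iN; rewrite add0n.
  have := h i; rewrite mem_iota add0n iN /= /pair_at !vw //; [exact| |].
    by exists i => //; right.
  by exists i => //; left.
- apply: sigma_cyl_of_local; first exact: (cmeas_preimage (fun b : bool => ~~ b) (cmeas_pair_at _)).
  move=> v w vw; rewrite /= /pair_at !vw //; first by right.
  by left.
Qed.

Lemma no_pair_null (R : realType) (p : R) (mu : probability OmegaM R) (x : nat -> int)
    (S : set config) : 0 < p < 1 -> is_bernoulli_product p mu ->
  (forall i j : nat, (i < j)%N -> x i + 1 < x j \/ x j + 1 < x i) ->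
  measurable (S : set OmegaM) -> (forall w, S w -> forall i, ~~ pair_at w (x i)) ->
  mu S = 0%E.
Proof.
move=> hp hmu xi mS SP; have /andP[p0 p1] := hp.
have Sle N : (mu S <= ((1 - p ^+ 2) ^+ N)%:E)%E.
  rewrite -(no_pair_measure N hmu xi); apply: le_measure; rewrite ?inE //.
    apply: (cmeas_preimage (fun b : bool => b)).
    apply: (@cmeas_ext _ (fun w => all negb [seq pair_at w (x i) | i <- iota 0 N])).
      by move=> w; rewrite all_map.
    exact: (cmeas_comp (all negb) (cmeas_map _ (fun i => cmeas_pair_at (x i)))).
  by move=> w Sw /=; apply/allP => i _; exact: SP.
have fS : mu S \is a fin_num by exact: fin_num_measure.
have S0 : (0 <= mu S)%E by exact: measure_ge0.
rewrite -(fineK fS); congr (_%:E); apply/eqP; rewrite eq_le fine_ge0 // andbT leNgt.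
apply/negP => x0.
have r1 : `|1 - p ^+ 2| < 1.
  have h1 : 0 < p ^+ 2 by rewrite exprn_gt0.
  have h2 : p ^+ 2 < 1 by rewrite expr_lt1 // ltW.
  by rewrite ger0_norm ?subr_ge0 ?ltrBlDr ?ltrDl // ltW.
have [N _ /(_ N (leqnn N)) /=] := cvgr0_norm_lt _ (cvg_expr r1) _ x0.
apply/negP; rewrite -leNgt.
have := Sle N; rewrite -{1}(fineK fS) lee_fin => /le_trans; apply; exact: ler_norm.
Qed.

(** * Countable family of windows around a volume *)

Definition lo (L : {fset int}) : int := Num.min (minb L) (maxb L) - 3.
Definition hi (L : {fset int}) : int := Num.max (minb L) (maxb L) + 3.

(** The margins leave room for the occupied pairs outside [L]; the minimum and maximum in [lo] and
    [hi] make the gap plain arithmetic, the empty volume included. *)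
Lemma lo_hi (L : {fset int}) : lo L + 6 <= hi L /\
  forall x, x \in L -> lo L + 1 < x < hi L - 1.
Proof.
rewrite /lo /hi; split; first by clear; lia.
move=> x xL; have h1 : minb L <= x - 1.
  by apply: minb_le; rewrite mem_barS subrK xL !orbT.
have h2 : x + 1 <= maxb L by apply: maxb_ge; rewrite mem_barS addrK xL.
by clear -h1 h2; lia.
Qed.

Definition ends (a : int) (n : nat) (z : config) : bool :=
  [&& z a, z (a + 1), z (a + n%:Z - 1) & z (a + n%:Z)].

(** The list [s] encodes the occupied sites of the pattern, so the index type is countable.
    [window (a - 1) n.+2] is the closed interval from [a] to [a + n]. *)
Definition window_cyl (L : {fset int}) (a : int) (n : nat) (s : seq int) : set config :=
  let z := fun x => x \in s in
  if [&& ends a n z, (3 < n)%N, a <= lo L & hi L <= a + n%:Z]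
  then cylF (window (a - 1) n.+2 `\` L)%fset z else set0.

Definition window_cyls (L : {fset int}) (k : nat) : set config :=
  if @choice.unpickle (int * nat * seq int)%type k is Some (a, n, s)
  then window_cyl L a n s else set0.

Lemma window_cyls_sigma L k : <<s cyl (Lc L) >> (window_cyls L k).
Proof.
have m0 := @measurable0 _ (g_sigma_algebraType (cyl (Lc L))).
rewrite /window_cyls; case: (choice.unpickle k) => [[[a n] s]|] //.
rewrite /window_cyl; case: ifP => // _; apply: cylF_sigma => i.
by rewrite in_fsetD => /andP[].
Qed.

(** Steps of 2 keep the candidate pairs disjoint; a right pair starting at [hi L - 1 + 2 * j] ends
    at [hi L + 2 * j], the end of the window. *)
Lemma window_cyls_cover L (v : config) (i j : nat) :
  pair_at v (lo L - 2 * i%:Z) -> pair_at v (hi L - 1 + 2 * j%:Z) ->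
  exists k, window_cyls L k v.
Proof.
move=> /andP[va va1] /andP[vb1 vb].
pose a := lo L - 2 * i%:Z; pose n := absz (hi L + 2 * j%:Z - a)%R.
have [h _] := lo_hi L.
have E : a + n%:Z = hi L + 2 * j%:Z by rewrite /n /a; clear -h; lia.
pose s := [seq x <- [seq a + k%:Z | k <- iota 0 n.+1] | v x].
have sE x : a <= x <= a + n%:Z -> v x = (x \in s).
  move=> xab; rewrite mem_filter; case: (v x) => //; rewrite andTb; apply/esym/mapP.
  by exists (absz (x - a)%R); [rewrite mem_iota|]; clear -xab; lia.
exists (choice.pickle (a, n, s)); rewrite /window_cyls choice.pickleK /window_cyl.
have n3 : (3 < n)%N by clear -E h; rewrite /a in E; lia.
rewrite /ends n3 -!sE; [|clear -n3; lia..].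
rewrite va va1 E; have -> : hi L + 2 * j%:Z - 1 = hi L - 1 + 2 * j%:Z by clear; lia.
have -> : hi L + 2 * j%:Z = hi L - 1 + 2 * j%:Z + 1 by clear; lia.
rewrite vb1 vb /=; have -> /= : a <= lo L by rewrite /a; clear; lia.
have -> : hi L <= hi L - 1 + 2 * j%:Z + 1 by clear; lia.
move=> x; rewrite in_fsetD mem_window => /andP[_ xab]; apply: sE.
by clear -xab; lia.
Qed.

(** Occupied pairs survive thinning. If no window fits [Tmap w], then [w] itself, whose spins are
    independent, misses all candidate pairs on one side of [L]. *)
Lemma no_window_null (R : realType) (p : R) (mu : probability OmegaM R) (L : {fset int})
    (A : set config) : 0 < p < 1 -> is_bernoulli_product p mu ->
  measurable (A : set OmegaM) -> (forall v, A v -> forall k, ~ window_cyls L k v) ->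
  mu (Tmap @^-1` A) = 0%E.
Proof.
move=> hp hmu mA AP; have mTA := Tmap_preimage mA.
have pairT w y : pair_at w y -> pair_at (Tmap w) y.
  by rewrite /pair_at /Tmap addrK => /andP[-> ->]; rewrite orbT.
pose SL := Tmap @^-1` A `&` [set w | forall i : nat, ~~ pair_at w (lo L - 2 * i%:Z)].
pose SR := Tmap @^-1` A `&` [set w | forall i : nat, ~~ pair_at w (hi L - 1 + 2 * i%:Z)].
have mall (x : nat -> int) : measurable ([set w | forall i, ~~ pair_at w (x i)] : set OmegaM).
  have -> : [set w | forall i, ~~ pair_at w (x i)] = \bigcap_i [set w | ~~ pair_at w (x i)].
    by apply/seteqP; split=> w /= h i; [move=> _|]; exact: h.
  apply: bigcap_measurableType => i _.
  exact: (cmeas_preimage (fun b : bool => ~~ b) (cmeas_pair_at _)).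
have mSL : measurable (SL : set OmegaM) by apply: measurableI => //; exact: mall.
have mSR : measurable (SR : set OmegaM) by apply: measurableI => //; exact: mall.
have SL0 : mu SL = 0%E.
  apply: (no_pair_null (x := fun i : nat => lo L - 2 * i%:Z) hp hmu _ mSL) => [i j ij|w []//].
  by right; clear -ij; lia.
have SR0 : mu SR = 0%E.
  apply: (no_pair_null (x := fun i : nat => hi L - 1 + 2 * i%:Z) hp hmu _ mSR) => [i j ij|w []//].
  by left; clear -ij; lia.
apply/eqP; rewrite eq_le measure_ge0 andbT.
apply: (@le_trans _ _ (mu (SL `|` SR))).
  apply: le_measure; rewrite ?inE //; first exact: measurableU.
  move=> w Aw; have [h|h] := pselect (forall i : nat, ~~ pair_at w (lo L - 2 * i%:Z)).
    by left.
  right; split => // j; apply/negP => wj; apply: h => i; apply/negP => wi.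
  by have [k] := window_cyls_cover (pairT _ _ wi) (pairT _ _ wj); exact: AP.
apply: (le_trans (measureU2 mu mSL mSR)).
by rewrite [X in (X + _)%E]SL0 [X in (_ + X)%E]SR0 adde0.
Qed.

Lemma gibbs_mass (R : realType) (p : R) (mu : probability OmegaM R) (L : {fset int})
    (A : set config) (xi : {ffun L -> bool}) :
  0 < p < 1 -> is_bernoulli_product p mu -> <<s cyl (Lc L) >> A ->
  mu (Tmap @^-1` A `&` [set w | restr L (Tmap w) = xi]) =
  (\int[mu]_(w in Tmap @^-1` A) (mass p (Tmap w) xi)%:E)%E.
Proof.
move=> hp hmu mA.
(* Index 0 collects the configurations that fit no window; [seqDU] then makes the pieces disjoint,
   still measurable with respect to the spins outside [L]. *)
pose C k := if k is k'.+1 then window_cyls L k' else ~` \bigcup_k window_cyls L k.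
have mC k : <<s cyl (Lc L) >> (C k).
  case: k => [|k] /=; last exact: window_cyls_sigma.
  apply: (@measurableC _ (g_sigma_algebraType (cyl (Lc L)))).
  apply: (@bigcupT_measurable _ (g_sigma_algebraType (cyl (Lc L)))) => k.
  exact: window_cyls_sigma.
have CT : \bigcup_k C k = setT.
  apply/seteqP; split=> // v _; have [[k _ h]|h] := pselect ((\bigcup_k window_cyls L k) v).
    by exists k.+1.
  by exists 0%N.
pose F k := A `&` seqDU C k.
have mF k : <<s cyl (Lc L) >> (F k).
  apply: (@measurableI _ (g_sigma_algebraType (cyl (Lc L)))) => //.
  exact: (@seqDU_measurable _ (g_sigma_algebraType (cyl (Lc L)))).
have FC k : F k `<=` C k by move=> v [_]; exact: subset_seqDU.
have tF : trivIset setT (fun k => Tmap @^-1` F k).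
  move=> i j _ _ [w [[_ wi] [_ wj]]]; apply: (trivIset_seqDU C) => //.
  by exists (Tmap w).
have AE : Tmap @^-1` A = \bigcup_k (Tmap @^-1` F k).
  rewrite -preimage_bigcup; congr (Tmap @^-1` _).
  by rewrite /F -setI_bigcupr -seqDU_bigcup_eq CT setIT.
have mTF k : measurable (Tmap @^-1` F k : set OmegaM).
  exact: (Tmap_preimage (sigma_cyl_measurable (mF k))).
have mass0 w : (0 <= (mass p (Tmap w) xi)%:E)%E.
  by rewrite lee_fin; apply: mass_ge0 => //; exact: Omega'_Tmap.
have mmass D : measurable_fun D (fun w : OmegaM => (mass p (Tmap w) xi)%:E).
  apply: (measurable_funS measurableT) => //; apply/measurable_EFinP => _ Y mY.
  by rewrite setTI; exact: (cmeas_preimage Y (cmeas_comp_Tmap (cmeas_mass p xi))).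
have mxi : measurable ([set w | restr L (Tmap w) = xi] : set OmegaM).
  exact: (cmeas_preimage [set xi] (cmeas_comp_Tmap (cmeas_restr L))).
rewrite AE ge0_integral_bigcup // setI_bigcupl measure_semi_bigcup; last 3 first.
- by move=> k; exact: measurableI.
- move=> i j _ _ [w [[wi _] [wj _]]]; apply: tF => //.
  by exists w.
- by rewrite -setI_bigcupl; apply: measurableI => //; exact: bigcupT_measurable.
apply: eq_eseriesr => k _; case: k => [|k].
  have F0 : mu (Tmap @^-1` F 0%N) = 0%E.
    apply: (no_window_null (L := L) hp hmu (sigma_cyl_measurable (mF _))).
    by move=> v /(FC 0%N) nv k wk; apply: nv; exists k.
  rewrite null_set_integral //; apply/eqP; rewrite eq_le measure_ge0 andbT -{}F0.
  by apply: le_measure; rewrite ?inE //; exact: measurableI.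
have := FC k.+1; rewrite /C /window_cyls.
have F0 : F k.+1 `<=` set0 -> mu (Tmap @^-1` F k.+1 `&` [set w | restr L (Tmap w) = xi]) =
    (\int[mu]_(w in Tmap @^-1` F k.+1) (mass p (Tmap w) xi)%:E)%E.
  by rewrite subset0 => ->; rewrite preimage_set0 set0I measure0 integral_set0.
case: (choice.unpickle k) => [[[a n] s]|] //.
rewrite /window_cyl; case: ifP => // /and4P[/and4P[za za1 zb1 zb] n3 alo hib] FW.
apply: (gibbs_window (z := fun x => x \in s) (a := a) (n := n)) => //.
  have [h] := lo_hi L; move=> Lh x /Lh; clear -alo hib h; lia.
move=> v /FW h x xab xL; apply: h; rewrite in_fsetD xL mem_window /=.
by clear -xab; lia.
Qed.

(** Once the spins in [L] equal [xi], membership in [B] becomes the event [G xi] outside [L], which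
    joins the conditioning event; summing [gibbs_mass] over [xi] concludes. *)
Lemma TBF_gibbs (R : realType) (p : R) (mu : probability OmegaM R) : 0 < p < 1 ->
  is_bernoulli_product p mu -> is_gibbs (gammaP p) (TBF mu).
Proof.
move=> hp hmu L B A FB [A0 [mA0 AE]]; have [B0 [mB0 BE]] := FB.
have mB := F'_measurable FB.
have mA : measurable (A : set OmegaM).
  by rewrite AE; apply: measurableI; [exact: measurable_Omega'|exact: sigma_cyl_measurable mA0].
have TO (X : set config) : Tmap @^-1` (Omega' `&` X) = Tmap @^-1` X.
  by apply/seteqP; split=> w /=; [case|split => //; exact: Omega'_Tmap].
have mT : measurable_fun [set: OmegaM] (Tmap : OmegaM -> OmegaM).
  by move=> _ Y mY; rewrite setTI; exact: Tmap_preimage.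
have mTA0 := Tmap_preimage (sigma_cyl_measurable mA0).
have mg : measurable_fun setT (fun w : OmegaM => (gammaP p L w B)%:E).
  apply/measurable_EFinP => _ Y mY; rewrite setTI.
  exact: (cmeas_preimage Y (cmeas_gammaP p L mB)).
rewrite [RHS](ge0_integral_pushforward mT) //; last 2 first.
- exact: measurable_funS mg.
- move=> v; rewrite inE AE => -[Ov _]; rewrite lee_fin; exact: gammaP_ge0.
rewrite AE TO.
pose G (xi : {ffun L -> bool}) := glue xi @^-1` B0.
have mG xi : <<s cyl (Lc L) >> (G xi) by exact: glue_sigma.
have mAG xi : <<s cyl (Lc L) >> (A0 `&` G xi).
  exact: (@measurableI _ (g_sigma_algebraType (cyl (Lc L))) _ _ mA0 (mG xi)).
have mass0 w (xi : {ffun L -> bool}) : (0 <= (mass p (Tmap w) xi)%:E)%E.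
  by rewrite lee_fin; apply: mass_ge0 => //; exact: Omega'_Tmap.
have mmass D (xi : {ffun L -> bool}) : measurable_fun D (fun w : OmegaM => (mass p (Tmap w) xi)%:E).
  apply: (measurable_funS measurableT) => //; apply/measurable_EFinP => _ Y mY.
  by rewrite setTI; exact: (cmeas_preimage Y (cmeas_comp_Tmap (cmeas_mass p xi))).
have mTG xi : measurable (Tmap @^-1` G xi : set OmegaM).
  exact: Tmap_preimage (sigma_cyl_measurable (mG xi)).
pose f (xi : {ffun L -> bool}) : OmegaM -> \bar R :=
  (fun w : OmegaM => (mass p (Tmap w) xi)%:E) \_ (Tmap @^-1` G xi).
transitivity (\int[mu]_(w in Tmap @^-1` A0) (\sum_(xi : {ffun L -> bool}) f xi w))%E; last first.
  apply: eq_integral => w _; rewrite /= gammaP_mass -sumEFin; apply: eq_bigr => xi _.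
  rewrite /f patchE /G BE; case: ifPn => [|/negP] h.
    rewrite inE in h; rewrite /mass; case: asboolP => O; last by rewrite mul0r.
    by rewrite indicE mem_set // mulr1.
  rewrite inE in h; rewrite indicE memNset ?mulr0 // => -[_ hB]; exact: h.
rewrite ge0_integral_sum //; last 2 first.
- move=> xi; apply: (measurable_funS measurableT) => //.
  by apply/(measurable_restrictT _ (mTG xi)).
- by move=> xi w _; rewrite /f patchE; case: ifP.
under eq_bigr => xi _.
  rewrite /f -integral_mkcondr -preimage_setI -(gibbs_mass xi hp hmu (mAG xi)).
over.
have -> : TBF mu (Omega' `&` A0 `&` B) = mu (Tmap @^-1` (A0 `&` B0)).
  by rewrite /TBF BE setIACA setIid TO.
rewrite (measure_partition mu (cmeas_comp_Tmap (cmeas_restr L))); last first.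
  by apply: Tmap_preimage; apply: measurableI => //; exact: sigma_cyl_measurable mA0.
apply: eq_bigr => xi _; congr (mu _); apply/seteqP.
have E w : restr L (Tmap w) = xi -> glue xi (Tmap w) = Tmap w.
  by move=> <-; exact: glue_restr.
split=> w /= [[Aw Bw] rw]; split=> //; split=> //.
  by rewrite /G /= E.
by move: Bw; rewrite /G /= E.
Qed.

Theorem theorem3p1 (R : realType) (p : R) (hp : 0 < p < 1)
    (mu : probability OmegaM R) (hmu : is_bernoulli_product p mu) :
  is_specification (gammaP p) /\ is_gibbs (gammaP p) (TBF mu).
Proof. by split; [exact: gammaP_specification|exact: TBF_gibbs]. Qed.
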